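(* Let $P$ be the transition probability matrix of an irreducible, aperiodic, positive recurrent $GI/G/1$-type Markov chain with blocks $A_k,B_k$ (as described in the context). Assume that $A=\sum_{k=-\infty}^{\infty}A_k$ is stochastic and that $\min(\phi_{A+},\phi_{B+})>1$. Let $1<z<\min(\phi_{A+},\phi_{B+},\eta)$, let $\mathbf{Y}=\mathbf{Y}(z)=(y_1,\dots,y_m)^t$ be the Perron–Frobenius right eigenvector of $A^*(z)$ corresponding to the eigenvalue $\chi(z)$, i.e. $A^*(z)\mathbf{Y}=\chi(z)\mathbf{Y}$, with $y_r\ge 1$ for all $r$, and set $V(i,r)=z^i y_r$ for $i\ge 0$, $1\le r\le m$. Then there exist a finite nonempty set $H$ of states and a constant $\lambda<1$ such that $$PV(i,r)\le \lambda V(i,r)\ \text{ for } (i,r)\notin H,\qquad PV(i,r)<\infty\ \text{ for } (i,r)\in H,$$ where $PV(i,r)=\sum_{(j,s)}P((i,r),(j,s))V(j,s)$.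
   Context: A $GI/G/1$-type Markov chain is a discrete-time Markov chain on the state space $\bigcup_{i\ge0}L_i$, $L_i=\{(i,j):j=1,\dots,m\}$ ($i$ is the level, $j$ the phase), whose stochastic transition matrix $P$ has $m\times m$ blocks $P_{i,k}$ (transitions from level $i$ to level $k$) given by $P_{0,k}=B_k$ for $k\ge0$, $P_{i,0}=B_{-i}$ for $i\ge1$, and $P_{i,k}=A_{k-i}$ for $i,k\ge1$, where $A_k,B_k$ ($k\in\mathbb{Z}$) are nonnegative $m\times m$ matrices. Standing assumption: $A=\sum_{k=-\infty}^{\infty}A_k$ is irreducible. $A^*(z)=\sum_{k=-\infty}^{\infty}z^kA_k$. $\phi_{A+}$ is the minimum over $(r,s)$ of the radii of convergence of the $(r,s)$ entries of $A^*_+(z)=\sum_{k\ge1}A_kz^k$; $\phi_{B+}$ is the minimum over $(r,s)$ of the radii of convergence of the $(r,s)$ entries of $B^*_+(z)=\sum_{k\ge1}B_kz^k$. For real $z>0$ for which $A^*(z)$ converges, $\chi(z)$ is the largest (Perron–Frobenius) eigenvalue of $A^*(z)$. Let $\Omega=\{z\in\mathbb{C}:1<|z|<\phi_{A+},\ \det(I-A^*(z))=0\}$. If $\Omega\ne\emptyset$, it is known that there is a positive real $z_0\in\Omega$ with $z_0\le|z|$ for all $z\in\Omega$, and $\eta:=z_0$; if $\Omega=\emptyset$, $\eta:=\infty$. *)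

(* Defs.v *)
From mathcomp Require Import all_boot all_order all_algebra.
From mathcomp Require Import all_classical all_reals all_analysis.
From mathcomp Require Import complex.
Set Implicit Arguments.
Unset Strict Implicit.
Unset Printing Implicit Defensive.
Import Order.TTheory GRing.Theory Num.Theory numFieldNormedType.Exports.
Import ComplexField.Normc.
Local Open Scope classical_set_scope.
Local Open Scope ring_scope.

Section MarkovChain.
Variables (R : realType) (S : choiceType) (P : S -> S -> R).

Definition stochastic_kernel : Prop :=
  (forall x y, 0 <= P x y) /\
  (forall x, (\esum_(y in [set: S]) (P x y)%:E = 1)%E).

Fixpoint nstep (n : nat) (x y : S) : \bar R :=
  if n is n'.+1 then (\esum_(w in [set: S]) ((P x w)%:E * nstep n' w y))%E
  else ((x == y)%:R)%:E.

(* Probability, starting from x, that the first visit to y at a time >= 1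
   takes place at time n. *)
Fixpoint first_passage (n : nat) (x y : S) : \bar R :=
  match n with
  | 0 => 0%E
  | n'.+1 =>
      match n' with
      | 0 => (P x y)%:E
      | _.+1 =>
          (\esum_(w in [set w | w != y]) ((P x w)%:E * first_passage n' w y))%E
      end
  end.

Definition irreducible_chain : Prop :=
  forall x y, exists n, (0 < nstep n x y)%E.

(* For every state, the gcd of its possible return times is 1. *)
Definition aperiodic_chain : Prop :=
  forall x (d : nat),
    (forall n, (0 < n)%N -> (0 < nstep n x x)%E -> (d %| n)%N) -> d = 1%N.

(* Return to each state is almost sure and has finite mean time. *)
Definition positive_recurrent_chain : Prop :=
  forall x,
    (\sum_(0 <= n <oo) first_passage n x x = 1)%E /\
    (\sum_(0 <= n <oo) (n%:R%:E * first_passage n x x) < +oo)%E.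

Definition kernel_apply (V : S -> R) (x : S) : \bar R :=
  (\esum_(y in [set: S]) (P x y * V y)%:E)%E.

End MarkovChain.

Section MatrixPredicates.
Variables (R : realType) (m : nat).

Definition nonneg_mx (M : 'M[R]_m) : Prop := forall r s, 0 <= M r s.

Definition stochastic_mx (M : 'M[R]_m) : Prop :=
  nonneg_mx M /\ forall r, \sum_s M r s = 1.

Definition irreducible_mx (M : 'M[R]_m) : Prop :=
  forall r s, exists n, 0 < (M ^+ n) r s.

(* The set of eigenvalues is finite, so the supremum is a maximum as soon as
   there is a real eigenvalue; for a nonnegative matrix it is the
   Perron-Frobenius eigenvalue. *)
Definition largest_eigenvalue (M : 'M[R]_m) : R :=
  sup [set x | eigenvalue M x].

End MatrixPredicates.

Section BilateralSeries.
Variable K : numFieldType.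

(* Sum over all integers k of f k: nonnegative indices plus negative ones. *)
Definition bisum (f : int -> K) : K :=
  limn (series (fun n => f n%:Z) : nat -> K^o) +
  limn (series (fun n => f (- n.+1%:Z)) : nat -> K^o).

Variable m : nat.

Definition mxbisum (A : int -> 'M[K]_m) : 'M[K]_m :=
  \matrix_(r, s) bisum (fun k => A k r s).

Definition Astar (A : int -> 'M[K]_m) (z : K) : 'M[K]_m :=
  mxbisum (fun k => z ^ k *: A k).

End BilateralSeries.

Section Radius.
Variable R : realType.

Definition convergence_radius (a : nat -> R) : \bar R :=
  ereal_sup [set r%:E | r in
    [set r : R | 0 <= r /\ cvgn (series (fun n => a n * r ^+ n))]].

Definition phi_plus (m : nat) (A : int -> 'M[R]_m) : \bar R :=
  \big[Order.min/+oo%E]_(p : 'I_m * 'I_m)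
    convergence_radius (fun n => if n == 0%N then 0 else A n%:Z p.1 p.2).

End Radius.

Section GIG1.
Variables (R : realType) (m : nat).

(* The state (i, j) has level i and phase j. *)
Definition state : Type := (nat * 'I_m)%type.

Variables A B : int -> 'M[R]_m.

Definition GIG1_block (i k : nat) : 'M[R]_m :=
  match i, k with
  | 0, _ => B k%:Z
  | _.+1, 0 => B (- i%:Z)
  | _.+1, _.+1 => A (k%:Z - i%:Z)
  end.

Definition GIG1_kernel (x y : state) : R := GIG1_block x.1 y.1 x.2 y.2.

Definition chi (z : R) : R := largest_eigenvalue (Astar A z).

Definition Astar_complex (z : R[i]) : 'M[R[i]]_m :=
  Astar (fun k => map_mx (real_complex R) (A k)) z.

Definition Omega : set R[i] :=
  [set z | [/\ 1 < normc z, ((normc z)%:E < phi_plus A)%E &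
               \det (1%:M - Astar_complex z) = 0]].

(* The least modulus of a point of Omega, +oo if Omega is empty; see
   [eta_empty] and [eta_min]. *)
Definition eta : \bar R := ereal_inf [set (normc z)%:E | z in Omega].

Lemma eta_empty : Omega = set0 -> eta = +oo%E.
Proof. by move=> O0; rewrite /eta O0 image_set0 ereal_inf0. Qed.

Lemma eta_min (z0 : R) : 0 < z0 -> Omega (real_complex R z0) ->
  (forall z, Omega z -> z0 <= normc z) -> eta = z0%:E.
Proof.
move=> z0_gt0 Oz0 z0_min; apply/eqP; rewrite eq_le; apply/andP; split.
  apply: ereal_inf_lbound; exists (real_complex R z0) => //=.
  by rewrite expr0n addr0 sqrtr_sqr gtr0_norm.
by apply: le_ereal_inf_tmp => _ [z Oz <-]; rewrite lee_fin z0_min.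
Qed.

Definition level_phase_function (z : R) (Y : 'cV[R]_m) (x : state) : R :=
  z ^+ x.1 * Y x.2 0.

End GIG1.

(* Main.v *)
Require Import Defs.
From mathcomp Require Import all_boot all_order all_algebra.
From mathcomp Require Import all_classical all_reals all_analysis.
From mathcomp Require Import complex.
From mathcomp Require Import ring lra zify.
Set Implicit Arguments.
Unset Strict Implicit.
Unset Printing Implicit Defensive.
Import Order.TTheory GRing.Theory Num.Theory numFieldNormedType.Exports.
Local Open Scope classical_set_scope.
Local Open Scope ring_scope.

(* Off level 0 one step of the chain multiplies V by about chi(z), so everything
   rests on chi(z) < 1. Let u solve the Poisson equation
   u - A u = beta - (pi beta) 1, where beta is the mean jump. If pi beta were
   nonnegative, (i, r) |-> i + u_r would be a submartingale off level 0 with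
   bounded mean descent, which positive recurrence excludes. So pi beta < 0 and
   v = 1 + e u satisfies A*(1 + e) v < v for small e > 0. As z < eta,
   I - A*(x) is invertible for 1 < x <= z, and x |-> (I - A*(x))^-1 1 is
   continuous and, where positive, at least 1; hence it stays positive up to z.
   This yields v > 0 with A*(z) v < v, and comparing Y with v gives
   chi(z) < 1. *)

(** * Mean hitting times *)

(** The condition z < eta only keeps 1 out of the spectrum of [Astar A x] for 1 < x <= z. It does
    not tell on which side of 1 the value chi(x) lies; positive recurrence decides this, just to the
    right of 1. The obstacle is that downward jumps carry no moment assumption: beta may be
    infinite, and then the Poisson equation cannot be posed with it. Downward jumps are therefore
    truncated at some K. Truncation only raises the drift, so a negative truncated drift still
    produces the supersolution; and if the truncated drift is nonnegative for every K, the downward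
    mean is finite and the submartingale argument applies to the true drift. Upward jumps are
    controlled by a radius t strictly between z and [phi_plus A]: the weight [t ^+ ppart k] is
    summable against the jumps and dominates the powers, the upward jumps and the remainder terms.
    Eigenvalues are bounded by comparing positive vectors, without Perron-Frobenius theory. *)

Lemma esumZl (R : realType) (T : choiceType) (I : set T) (c : R)
    (a : T -> \bar R) :
  0 <= c -> (forall i, 0 <= a i)%E ->
  (\esum_(i in I) (c%:E * a i) = c%:E * \esum_(i in I) a i)%E.
Proof.
move=> c0 a0; rewrite /esum -ereal_supZl//; last first.
  by apply/set0P; eexists; exists set0 => //; exact: fsets_set0.
congr ereal_sup; rewrite [RHS]image_comp.
by apply: eq_imagel => F [finF FI] /=; rewrite ge0_mule_fsumr.
Qed.

Lemma esum_swap (R : realType) (S T : choiceType) (I : set S) (J : set T)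
    (a : S -> T -> \bar R) :
  (forall i j, 0 <= a i j)%E ->
  (\esum_(i in I) \esum_(j in J) a i j =
   \esum_(j in J) \esum_(i in I) a i j)%E.
Proof.
move=> a0; rewrite !esum_esum//.
rewrite (@reindex_esum _ _ _ (I `*`` (fun=> J)) (J `*`` (fun=> I))
  (fun p => (p.2, p.1)))//.
split=> [[x y] [? ?]//|[x y] [x' y'] _ _ /= [-> ->]//|[x y] [? ?]].
by exists (y, x).
Qed.

Lemma esum_nneseries (R : realType) (T : choiceType) (I : set T)
    (a : T -> nat -> \bar R) :
  (forall i k, 0 <= a i k)%E ->
  (\esum_(i in I) \sum_(0 <= k <oo) a i k =
   \sum_(0 <= k <oo) \esum_(i in I) a i k)%E.
Proof.
move=> a0; rewrite nneseries_esumT; last by move=> k; exact: esum_ge0.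
by rewrite esum_swap//; apply: eq_esum => i _; rewrite nneseries_esumT.
Qed.

Section hitting_time.
Variables (R : realType) (S : choiceType) (P : S -> S -> R).
Hypothesis P_stoch : stochastic_kernel P.
Variable o : S.
Implicit Types (f g : S -> \bar R).

Let P_ge0 x y : 0 <= P x y. Proof. by case: P_stoch. Qed.

Definition taboo_step f (x : S) : \bar R :=
  (\esum_(w in [set w | w != o]) ((P x w)%:E * f w))%E.

Fixpoint survival (n : nat) : S -> \bar R :=
  if n is n'.+1 then taboo_step (survival n') else cst 1%E.

(** If T is the first time >= 1 at which the chain started at x visits [o], then [survival n x] is
    P(T > n), so this is the mean of the positive part of T - n; for n = 0 it is the mean hitting
    time. *)
Definition residual_time (n : nat) (x : S) : \bar R :=
  (\sum_(0 <= k <oo) survival (n + k) x)%E.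

Lemma taboo_step_ge0 f : (forall x, 0 <= f x)%E ->
  forall x, (0 <= taboo_step f x)%E.
Proof. by move=> f0 x; apply: esum_ge0 => w _; rewrite mule_ge0// lee_fin. Qed.

Lemma le_taboo_step f g : (forall x, f x <= g x)%E ->
  forall x, (taboo_step f x <= taboo_step g x)%E.
Proof. by move=> fg x; apply: le_esum => w _; rewrite lee_wpmul2l// lee_fin. Qed.

Lemma taboo_stepD f g : (forall x, 0 <= f x)%E -> (forall x, 0 <= g x)%E ->
  forall x,
    taboo_step (fun y => f y + g y)%E x = (taboo_step f x + taboo_step g x)%E.
Proof.
move=> f0 g0 x; rewrite /taboo_step -esumD; last 2 first.
- by move=> w _; rewrite mule_ge0// lee_fin.
- by move=> w _; rewrite mule_ge0// lee_fin.
by apply: eq_esum => w _; rewrite ge0_muleDr.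
Qed.

Lemma taboo_stepZ (c : R) f : 0 <= c -> (forall x, 0 <= f x)%E ->
  forall x, taboo_step (fun y => c%:E * f y)%E x = (c%:E * taboo_step f x)%E.
Proof.
move=> c0 f0 x; rewrite /taboo_step -esumZl//; last first.
  by move=> w; rewrite mule_ge0// lee_fin.
by apply: eq_esum => w _; rewrite muleCA.
Qed.

Lemma taboo_step_sum f x : (forall y, 0 <= f y)%E ->
  (\esum_(w in [set: S]) ((P x w)%:E * f w) =
   (P x o)%:E * f o + taboo_step f x)%E.
Proof.
move=> f0; have Pf0 w : (0 <= (P x w)%:E * f w)%E by rewrite mule_ge0// lee_fin.
rewrite (esumID [set o])// setTI setTI esum_set1//; congr (_ + _)%E.
by rewrite /taboo_step; congr (esum _ _); apply/seteqP; split => w /= /eqP.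
Qed.

Lemma survival_ge0 n x : (0 <= survival n x)%E.
Proof. by elim: n x => [|n IH] x //=; exact: taboo_step_ge0. Qed.

Lemma taboo_step_series (s : nat -> S -> \bar R) x :
  (forall k y, 0 <= s k y)%E ->
  taboo_step (fun y => \sum_(0 <= k <oo) s k y)%E x =
  (\sum_(0 <= k <oo) taboo_step (s k) x)%E.
Proof.
move=> s0; rewrite /taboo_step -esum_nneseries; last first.
  by move=> w k; rewrite mule_ge0// lee_fin.
by apply: eq_esum => w _; rewrite nneseriesZl.
Qed.

Lemma taboo_step_residual n x :
  taboo_step (residual_time n) x = residual_time n.+1 x.
Proof.
by rewrite /residual_time taboo_step_series// => k y; exact: survival_ge0.
Qed.

Lemma residual_time_ge0 n x : (0 <= residual_time n x)%E.
Proof. by apply: nneseries_ge0 => *; exact: survival_ge0. Qed.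

Lemma residual_timeS n x :
  residual_time n x = (survival n x + residual_time n.+1 x)%E.
Proof.
rewrite /residual_time nneseries_recl//; last by move=> *; exact: survival_ge0.
rewrite addn0; congr (_ + _)%E.
rewrite -(@nneseries_addn _ (fun k => survival (n + k) x))//; last first.
  by move=> *; exact: survival_ge0.
by apply: eq_eseriesr => k _; rewrite addn1 addnS addSn.
Qed.

Lemma residual_time_cvg0 x : (residual_time 0 x < +oo)%E ->
  residual_time n x @[n --> \oo] --> 0%E.
Proof.
move=> tx; have := @nneseries_tail_cvg R (fun k => survival k x) xpredT tx.
move=> /(_ (fun k _ => survival_ge0 k x)); apply: cvg_trans.
apply: near_eq_cvg; apply: nearW => n; rewrite /residual_time.
rewrite -(@nneseries_addn _ (fun k => survival k x))//.
  by apply: eq_eseriesr => k _; rewrite addnC.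
by move=> *; exact: survival_ge0.
Qed.

Lemma survival_le1 n x : (survival n x <= 1)%E.
Proof.
elim: n x => [|n IH] x //=.
apply: (le_trans (le_taboo_step IH x)).
have [_ /(_ x) P1] := P_stoch; rewrite -[leRHS]P1.
rewrite (eq_esum (b := fun y => (P x y)%:E * cst 1 y)%E); last first.
  by move=> y _; rewrite mule1.
by rewrite (@taboo_step_sum (cst 1%E))//= leeDr// mule1 lee_fin.
Qed.

Lemma first_passage_ge0 n x : (0 <= first_passage P n x o)%E.
Proof.
elim: n x => [|[|n] IH] x //=; first by rewrite lee_fin.
by apply: esum_ge0 => w _; rewrite mule_ge0 ?lee_fin// IH.
Qed.

Lemma survival_first_passage n x :
  survival n x = (survival n.+1 x + first_passage P n.+1 x o)%E.
Proof.
elim: n x => [|n IH] x.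
  have [_ /(_ x) P1] := P_stoch; rewrite -[LHS]P1.
  rewrite (eq_esum (b := fun y => (P x y)%:E * cst 1 y)%E); last first.
    by move=> y _; rewrite mule1.
  by rewrite (@taboo_step_sum (cst 1%E))//= addeC mule1.
rewrite [LHS]/= (_ : survival n = fun y =>
  (survival n.+1 y + first_passage P n.+1 y o)%E); last exact/funext.
rewrite taboo_stepD//; [exact: survival_ge0|move=> y; exact: first_passage_ge0].
Qed.

Lemma survival_fin_num n x : survival n x \is a fin_num.
Proof.
by rewrite ge0_fin_numE ?survival_ge0// (le_lt_trans (survival_le1 _ _))// ltry.
Qed.

Lemma first_passage_fin_num n x : first_passage P n x o \is a fin_num.
Proof.
case: n => // n; rewrite ge0_fin_numE ?first_passage_ge0//.
apply: (@le_lt_trans _ _ 1%E); last exact: ltry.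
apply: le_trans (survival_le1 n x).
by rewrite survival_first_passage leeDr// survival_ge0.
Qed.

End hitting_time.

(** * Submartingales in a positive recurrent chain *)

Section positive_recurrence.
Variables (R : realType) (S : choiceType) (P : S -> S -> R).
Hypothesis P_stoch : stochastic_kernel P.
Hypothesis P_irr : irreducible_chain P.
Hypothesis P_rec : positive_recurrent_chain P.
Variable o : S.

Let P_ge0 x y : 0 <= P x y. Proof. by case: P_stoch. Qed.

(* Abel summation: the sum of the tails [survival n o] is the mean return time,
   because [survival N o] tends to [0]. *)
Lemma residual_time_base : (residual_time P o 0 o < +oo)%E.
Proof.
have [fp_sum1 fp_mean] := P_rec o.
pose f n := fine (first_passage P n.+1 o o).
have fE n : (f n)%:E = first_passage P n.+1 o o.
  by rewrite fineK// first_passage_fin_num.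
have f_ge0 n : 0 <= f n by rewrite -lee_fin fE first_passage_ge0.
pose s n := fine (survival P o n o).
have sE n : (s n)%:E = survival P o n o by rewrite fineK// survival_fin_num.
have sS n : s n = s n.+1 + f n.
  by apply: EFin_inj; rewrite EFinD !sE fE -survival_first_passage.
have s0 : s 0 = 1 by [].
have {}fp_sum1 : (\sum_(0 <= k <oo) (f k)%:E = 1)%E.
  rewrite -fp_sum1 [RHS]nneseries_recl//=; last first.
    by move=> k _; exact: first_passage_ge0.
  rewrite add0e -(@nneseries_addn _ (fun k => first_passage P k o o))//; last first.
    by move=> k; exact: first_passage_ge0.
  by apply: eq_eseriesr => k _; rewrite addn1 fE.
pose C := fine (\sum_(0 <= n <oo) (n%:R%:E * first_passage P n o o))%E.
have meanC n : \sum_(0 <= k < n) k.+1%:R * f k <= C.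
  have nf0 k : (0 <= k%:R%:E * first_passage P k o o)%E.
    by rewrite mule_ge0 ?lee_fin// first_passage_ge0.
  rewrite -lee_fin /C fineK; last first.
    by rewrite ge0_fin_numE//; apply: nneseries_ge0.
  rewrite [leRHS]nneseries_recl// mul0e add0e.
  rewrite -(@nneseries_addn _ (fun k => k%:R%:E * first_passage P k o o)%E)//.
  rewrite -sumEFin; under eq_bigr do rewrite EFinM fE -addn1.
  apply: (@nneseries_lim_ge _ (fun k : nat =>
    ((k + 1)%:R%:E * first_passage P (k + 1)%N o o)%E)) => k _ _.
  exact: nf0.
have sum_sE N : \sum_(0 <= n < N) s n = \sum_(0 <= k < N) k.+1%:R * f k + N%:R * s N.
  elim: N => [|N IH]; first by rewrite !big_geq// mul0r addr0.
  by rewrite !big_nat_recr//= IH (sS N) -natr1; ring.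
(* The boundary term [N%:R * s N] of the Abel summation is not known to be bounded. Moving the
   horizon to N + d turns it into [N%:R * s (N + d)], which vanishes as d grows with N fixed. *)
have sum_s_le N d :
    \sum_(0 <= n < N) s n <= \sum_(0 <= k < N + d) k.+1%:R * f k + N%:R * s (N + d)%N.
  elim: d => [|d IH]; first by rewrite addn0 sum_sE.
  apply: (le_trans IH); rewrite addnS big_nat_recr//= (sS (N + d)%N) mulrDr addrA.
  rewrite addrAC lerD2r lerD2l ler_wpM2r// ler_nat; lia.
have s_sum n : s n = 1 - \sum_(0 <= k < n) f k.
  elim: n => [|n IH]; first by rewrite big_geq// subr0.
  by rewrite big_nat_recr//= opprD addrA -IH (sS n) addrK.
have s_cvg : s n @[n --> \oo] --> 0.
  rewrite (_ : s = fun n => 1 - \sum_(0 <= k < n) f k); last exact/funext.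
  rewrite -[X in _ --> X](subrr (1 : R)); apply: cvgB; first exact: cvg_cst.
  have : (\sum_(0 <= k < n) (f k)%:E @[n --> \oo] --> 1%E)%E.
    rewrite -fp_sum1; apply: is_cvg_nneseries => n _ _; by rewrite lee_fin.
  under eq_fun do rewrite sumEFin.
  by move/fine_cvg.
have sum_sC N : \sum_(0 <= n < N) s n <= C.
  have : C + N%:R * s n @[n --> \oo] --> C.
    rewrite -[X in _ --> X]addr0 -[X in _ --> _ + X](mulr0 (N%:R)).
    apply: cvgD; first exact: cvg_cst.
    by apply: cvgM; first exact: cvg_cst.
  move=> h; rewrite -(cvg_lim _ h)//; apply: limr_ge.
    by apply/cvg_ex; exists C.
  near=> n; apply: (le_trans (sum_s_le N (n - N)%N)).
  by rewrite subnKC ?lerD2r ?meanC//; near: n; exists N.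
apply: (@le_lt_trans _ _ C%:E); last exact: ltry.
apply: lime_le.
  by apply: is_cvg_nneseries => n _ _; exact: survival_ge0.
apply: nearW => n; under eq_bigr do rewrite add0n -sE.
by rewrite sumEFin lee_fin.
Unshelve. all: by end_near. Qed.

(** The mean hitting time at y is at least [P y w] times the one at w, for w other than [o].
    Finiteness thus propagates from [o] along transitions of positive probability, and
    irreducibility reaches every state. *)
Lemma residual_time_finite x : (residual_time P o 0 x < +oo)%E.
Proof.
have step y w : (residual_time P o 0 y < +oo)%E -> 0 < P y w ->
    (residual_time P o 0 w < +oo)%E.
  move=> ty Pyw; have [->|wo] := eqVneq w o; first exact: residual_time_base.
  rewrite residual_timeS// -taboo_step_residual// in ty.
  rewrite ltey; apply: contraTneq ty => tw.
  rewrite -leNgt leye_eq; apply/eqP.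
  rewrite /taboo_step (esumID [set w])//; last first.
    by move=> v _; rewrite mule_ge0 ?lee_fin// residual_time_ge0.
  rewrite setIidr ?esum_set1 ?tw; last 2 first.
  - by rewrite mule_ge0 ?lee_fin ?leey.
  - by move=> v /= ->; exact: wo.
  rewrite gt0_muley ?lte_fin// addye ?addey//.
  rewrite gt_eqF// (lt_le_trans (ltNyr 0))//; apply: esum_ge0 => v _.
  by rewrite mule_ge0 ?lee_fin// residual_time_ge0.
have reach n y : (residual_time P o 0 y < +oo)%E -> (0 < nstep P n y x)%E ->
    (residual_time P o 0 x < +oo)%E.
  elim: n y => [|n IH] y ty /=.
    by rewrite lte_fin; case: (eqVneq y x) => [<-//|_]; rewrite ltxx.
  move=> nstep_gt0.
  have [w [Pyw nw]] : exists w, 0 < P y w /\ (0 < nstep P n w x)%E.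
    apply: contrapT => no; move: nstep_gt0; rewrite esum1 ?ltxx// => w _.
    have nw0 : (0 <= nstep P n w x)%E.
      elim: (n) (w) => [|k IHk] v /=; first by rewrite lee_fin.
      by apply: esum_ge0 => u _; rewrite mule_ge0 ?lee_fin.
    have [Pw|Pw] := ltP 0 (P y w); last first.
      by have /eqP -> : P y w == 0; [rewrite eq_le Pw P_ge0|rewrite mul0e].
    have [nw|nw] := ltP 0%E (nstep P n w x); first by case: no; exists w.
    by have /eqP -> : nstep P n w x == 0%E; [rewrite eq_le nw nw0|rewrite mule0].
  by apply: (IH w) => //; exact: step ty Pyw.
by have [n] := P_irr o x; apply: reach; exact: residual_time_base.
Qed.

(* Up to the hitting time of [o], [l] decreases by at most [C] per step on
   average, so [l <= C * t] with [t] the mean hitting time. Iterating the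
   submartingale inequality then bounds [g] by the tails of the series [t]. *)
Lemma bounded_descent_submartingale_eq0 (l g : S -> R) (C : R) :
  0 <= C -> (forall x, 0 <= g x) -> (forall x, g x <= l x) -> l o = 0 ->
  (forall x, \esum_(y in [set: S]) (P x y * Num.max (l x - l y) 0)%:E <= C%:E)%E ->
  (forall x, (g x)%:E <= \esum_(y in [set: S]) (P x y * g y)%:E)%E ->
  forall x, g x = 0.
Proof.
move=> C0 g0 gl lo descent sub x.
have l0 y : 0 <= l y by exact: le_trans (g0 y) (gl y).
have go : g o = 0 by apply/eqP; rewrite eq_le g0 andbT -lo gl.
(* Capping [l] at N bounds what is left after n steps by N times the survival probability, although
   nothing is known yet about the mean of [l]. *)
have trunc_le (N : R) n y : 0 <= N ->
    ((Num.min (l y) N)%:E <=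
     C%:E * \sum_(0 <= k < n) survival P o k y + N%:E * survival P o n y)%E.
  move=> N0; elim: n y => [|n IH] y.
    by rewrite big_geq// mule0 add0e mule1 lee_fin ge_min lexx orbT.
  have lN0 w : 0 <= Num.min (l w) N by rewrite le_min l0.
  have : ((Num.min (l y) N)%:E <= C%:E +
          taboo_step P o (fun w => (Num.min (l w) N)%:E) y)%E.
    have [_ /(_ y) P1] := P_stoch.
    rewrite -[leLHS]mule1 -P1 -esumZl//; last by move=> w; rewrite lee_fin.
    apply: (@le_trans _ _ (\esum_(w in [set: S])
       ((P y w * Num.max (l y - l w) 0)%:E + (P y w)%:E * (Num.min (l w) N)%:E)))%E.
      apply: le_esum => w _; rewrite -!EFinM -EFinD lee_fin -mulrDr mulrC.
      rewrite ler_wpM2l//; case: (leP (l y) N); case: (leP (l w) N);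
        case: (leP (l y - l w) 0); move: (l0 w) (l0 y) N0; lra.
    rewrite esumD; last 2 first.
    - by move=> w _; rewrite lee_fin mulr_ge0// le_max lexx orbT.
    - by move=> w _; rewrite mule_ge0// lee_fin.
    apply: leeD; first exact: descent.
    by rewrite (taboo_step_sum P_stoch o)// lo min_l// mule0 add0e.
  move=> h; apply: (le_trans h); rewrite big_nat_recl//.
  rewrite ge0_muleDr ?survival_ge0 ?sume_ge0//; last by move=> *; exact: survival_ge0.
  rewrite /= mule1 -addeA leeD2l//.
  apply: le_trans (@le_taboo_step _ _ _ P_stoch o _ _ IH y) _.
  have s0 k w := survival_ge0 P_stoch o k w.
  have ss0 w : (0 <= \sum_(0 <= k < n) survival P o k w)%E by exact: sume_ge0.
  rewrite taboo_stepD//; last 2 first.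
  - by move=> w; rewrite mule_ge0// lee_fin.
  - by move=> w; rewrite mule_ge0// lee_fin.
  rewrite !taboo_stepZ// leeD2r// lee_wpmul2l ?lee_fin//.
  rewrite /taboo_step -esum_sum; last by move=> w k _ _; rewrite mule_ge0// lee_fin.
  by apply: le_esum => w _; rewrite ge0_sume_distrr.
have l_le y : ((l y)%:E <= C%:E * residual_time P o 0 y)%E.
  have s0 k w := survival_ge0 P_stoch o k w.
  have ty := residual_time_finite y.
  (* The cap N = [l y] costs nothing at y itself. The leftover term vanishes in the limit because
     [survival] is bounded by [residual_time]. *)
  have -> : l y = Num.min (l y) (l y) by rewrite minxx.
  have : (C%:E * residual_time P o 0 y + (l y)%:E * residual_time P o n y @[n --> \oo]
          --> C%:E * residual_time P o 0 y)%E.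
    rewrite -[X in _ --> X]adde0 -[X in _ --> (_ + X)%E](mule0 (l y)%:E).
    apply: cvgeD; first by rewrite mule0 fin_num_adde_defl.
      exact: cvg_cst.
    by apply: cvgeZl => //; exact: residual_time_cvg0.
  move=> h; rewrite -(cvg_lim _ h)//; apply: lime_ge.
    by apply/cvg_ex; eexists; exact: h.
  apply: nearW => n; apply: (le_trans (trunc_le (l y) n y (l0 y))).
  apply: leeD.
    rewrite lee_wpmul2l ?lee_fin//.
    by apply: nneseries_lim_ge => k _ _; exact: s0.
  rewrite lee_wpmul2l ?lee_fin// (residual_timeS P_stoch).
  by rewrite leeDl// residual_time_ge0.
have g_le n y : ((g y)%:E <= C%:E * residual_time P o n y)%E.
  elim: n y => [|n IH] y; first by apply: le_trans (l_le y); rewrite lee_fin.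
  apply: (le_trans (sub y)).
  under eq_esum do rewrite EFinM.
  rewrite (taboo_step_sum P_stoch o) => [|w]; last by rewrite lee_fin.
  rewrite go mule0 add0e.
  apply: le_trans (@le_taboo_step _ _ _ P_stoch o _ _ IH y) _.
  rewrite taboo_stepZ// ?taboo_step_residual// => w; exact: residual_time_ge0.
apply/eqP; rewrite eq_le g0 andbT -lee_fin.
have : (C%:E * residual_time P o n x @[n --> \oo] --> C%:E * 0)%E.
  apply: cvgeZl => //; apply: residual_time_cvg0 => //.
  exact: residual_time_finite.
rewrite mule0 => h; rewrite -[leRHS](cvg_lim _ h)//; apply: lime_ge.
  by apply/cvg_ex; eexists; exact: h.
exact: nearW.
Qed.

End positive_recurrence.

(** * Stochastic and nonnegative matrices *)

Section stochastic_matrix.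
Variables (R : realType) (m : nat).
Implicit Types (A M : 'M[R]_m) (u v : 'cV[R]_m).

Lemma stochastic_mxX A n : stochastic_mx A -> stochastic_mx (A ^+ n).
Proof.
move=> [A0 A1]; elim: n => [|n [IH0 IH1]].
  split=> [r s|r]; first by rewrite expr0 mxE.
  rewrite (bigD1 r)//= expr0 !mxE eqxx big1 ?addr0// => s sr.
  by rewrite mxE eq_sym (negbTE sr).
split=> [r s|r]; rewrite exprS.
  by rewrite mxE sumr_ge0// => t _; rewrite mulr_ge0.
under eq_bigr do rewrite mxE.
by rewrite exchange_big/= -[RHS](A1 r); apply: eq_bigr => t _; rewrite -mulr_sumr IH1 mulr1.
Qed.

Lemma le_mulmx_nonneg M u v : nonneg_mx M -> (forall r, u r 0 <= v r 0) ->
  forall r, (M *m u) r 0 <= (M *m v) r 0.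
Proof. by move=> M0 uv r; rewrite !mxE ler_sum// => s _; rewrite ler_wpM2l. Qed.

(** Minimum principle: at a minimum r0 of u, row r0 of [A ^+ n] averages values that are all at
    least [u r0 0], and the average does not exceed it. Every s charged by that row therefore has
    the minimal value. *)
Lemma superharmonic_const A u : stochastic_mx A -> irreducible_mx A ->
  (forall r, (A *m u) r 0 <= u r 0) -> forall r s, u r 0 = u s 0.
Proof.
move=> Astoch Airr super r.
have [r0 _ min_r0] := @arg_minP _ _ _ r xpredT (fun i => u i 0) isT.
suff u_r0 s : u s 0 = u r0 0 by move=> s; rewrite !u_r0.
have [n Anpos] := Airr r0 s.
have superX : (A ^+ n *m u) r0 0 <= u r0 0.
  elim: (n) r0 {min_r0 Anpos} => [|k IH] t; first by rewrite expr0 mul1mx.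
  rewrite exprS -mulmxA; apply: le_trans (super t).
  by apply: le_mulmx_nonneg => //; case: Astoch.
have [An0 An1] := stochastic_mxX n Astoch.
have : \sum_t (A ^+ n) r0 t * (u t 0 - u r0 0) <= 0.
  under eq_bigr do rewrite mulrBr.
  by rewrite sumrB -mulr_suml An1 mul1r subr_le0; move: superX; rewrite mxE.
rewrite (bigD1 s)//= => le0.
have : (A ^+ n) r0 s * (u s 0 - u r0 0) <= 0.
  apply: le_trans le0; rewrite lerDl sumr_ge0// => t _.
  by rewrite mulr_ge0// subr_ge0 min_r0.
rewrite pmulr_rle0// subr_le0 => us; apply/eqP; rewrite eq_le us/=.
exact: min_r0.
Qed.

(* With [J] the all-ones matrix, [1 - A + J] is invertible; its inverse [G]
   solves the Poisson equation, and [p] is the stationary distribution. *)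
Lemma poisson_equation A : stochastic_mx A -> irreducible_mx A ->
  exists (G : 'M[R]_m) (p : 'rV[R]_m), (forall r, 0 < p 0 r) /\
    G - A *m G = 1%:M - (const_mx 1 : 'cV_m) *m p.
Proof.
move=> Astoch Airr; have [A0 A1] := Astoch.
pose J : 'M[R]_m := const_mx 1.
have JE : J = (const_mx 1 : 'cV_m) *m (const_mx 1 : 'rV_m).
  by apply/matrixP => i j; rewrite !mxE big_ord1 !mxE mulr1.
have drift_max (u : 'cV[R]_m) (r : 'I_m) : exists t, u t 0 - (A *m u) t 0 >= 0.
  have [t _ max_t] := @arg_maxP _ _ _ r xpredT (fun i => u i 0) isT.
  exists t; rewrite subr_ge0 mxE -[leRHS]mul1r -(A1 t) mulr_suml.
  by apply: ler_sum => s _; rewrite ler_wpM2l//; exact: max_t.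
have drift_min (u : 'cV[R]_m) (r : 'I_m) : exists t, u t 0 - (A *m u) t 0 <= 0.
  have [t] := drift_max (- u) r; rewrite mulmxN !mxE => h; exists t.
  by move: h; rewrite !mxE; lra.
(* A kernel vector u satisfies u - A u = - c, where c is the sum of its entries. The left side is
   nonnegative at a maximum of u and nonpositive at a minimum, so c = 0; then u is constant with
   zero sum. *)
have Bunit : 1%:M - A + J \in unitmx.
  rewrite -unitmx_tr unitmxE unitfE; apply/det0P => -[w w0 wB].
  have {wB} : (1%:M - A + J) *m w^T = 0.
    by rewrite -[X in X *m _]trmxK -trmx_mul wB trmx0.
  set u := w^T; have u0 : u != 0 by rewrite trmx_eq0.
  rewrite mulmxDl mulmxBl mul1mx JE -mulmxA => uB.
  pose c := ((const_mx 1 : 'rV_m) *m u) 0 0.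
  have uBr r : u r 0 - (A *m u) r 0 + c = 0.
    have := congr1 (fun M : 'cV_m => M r 0) uB; rewrite /c !mxE big_ord1 !mxE mul1r.
    exact.
  case/matrix0Pn: u0 => r [k]; rewrite (ord1 k) => ur0.
  have c0 : c = 0.
    have [t ht] := drift_max u r; have [t' ht'] := drift_min u r.
    by move: (uBr t) (uBr t'); lra.
  have uconst := @superharmonic_const A u Astoch Airr _ r.
  have {}uconst s : u r 0 = u s 0.
    by apply: uconst => t; move: (uBr t); rewrite c0; lra.
  move: c0; rewrite /c mxE; under eq_bigr do rewrite mxE mul1r -uconst.
  rewrite sumr_const card_ord => /eqP; rewrite mulrn_eq0 (negbTE ur0) orbF.
  by case: (m) (r) => [[]|].
pose G := invmx (1%:M - A + J); pose p := (const_mx 1 : 'rV_m) *m G.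
have GE : G - A *m G = 1%:M - (const_mx 1 : 'cV_m) *m p.
  apply/eqP; rewrite eq_sym subr_eq; apply/eqP.
  by rewrite mulmxA -JE -[X in X - _]mul1mx -mulmxBl -mulmxDl mulmxV.
exists G, p; split=> // r.
pose u := col r G.
have uE t : u t 0 - (A *m u) t 0 = (t == r)%:R - p 0 r.
  have := congr1 (fun M : 'M[R]_m => M t r) GE.
  rewrite !mxE big_ord1 !mxE mul1r => <-; congr (_ - _).
  by apply: eq_bigr => s _; rewrite !mxE.
(* If [p 0 r] were nonpositive, column r of G would be superharmonic, hence constant, and its
   equation at r would read 0 = 1 - p r. *)
rewrite ltNge; apply/negP => p_le0.
have uconst := @superharmonic_const A u Astoch Airr _ r.
have {}uconst s : u r 0 = u s 0.
  apply: uconst => t; rewrite -subr_ge0 uE subr_ge0.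
  by apply: le_trans p_le0 _; rewrite ler0n.
have := uE r; rewrite [X in _ - X]mxE; under eq_bigr do rewrite -uconst.
rewrite -mulr_suml A1 mul1r subrr eqxx => /esym/eqP; rewrite subr_eq0 => /eqP p1.
by move: p_le0; rewrite -p1 ler10.
Qed.

End stochastic_matrix.

(** * Comparison with strict supersolutions *)

Section strict_supersolution.
Variables (R : realType) (m : nat).
Implicit Types (M : 'M[R]_m) (u v : 'cV[R]_m).

(** Let t maximize u / v, with maximum c. Then u <= c v with equality at t, so x u_t = (M u)_t <= c
    (M v)_t < c v_t = u_t. *)
Lemma eigenvalue_lt1 M v u (x : R) : (0 < m)%N -> nonneg_mx M ->
  (forall r, 0 < v r 0) -> (forall r, (M *m v) r 0 < v r 0) ->
  (forall r, 0 < u r 0) -> M *m u = x *: u -> x < 1.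
Proof.
move=> m0 M0 v0 Mv u0 Mu.
have [t _ max_t] :=
  @arg_maxP _ _ _ (Ordinal m0) xpredT (fun i => u i 0 / v i 0) isT.
have uv r : u r 0 <= (u t 0 / v t 0 *: v) r 0.
  by rewrite mxE -ler_pdivrMr//; exact: max_t.
have := le_mulmx_nonneg M0 uv t; rewrite Mu -scalemxAr !mxE => h.
rewrite -(ltr_pM2r (u0 t)) mul1r; apply: (le_lt_trans h).
have ct : 0 < u t 0 / v t 0 by rewrite divr_gt0.
have := Mv t; rewrite mxE -(ltr_pM2l ct); rewrite [ltRHS]mulfVK ?gt_eqF//.
Qed.

(** If the minimum c of u / v, attained at t, were negative, then u >= c v would give (M u)_t >= c
    (M v)_t > c v_t = u_t, against u = 1 + M u. So u is nonnegative, and the equation lifts it to at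
    least 1. *)
Lemma solution_ge1_of_supersolution M v u : nonneg_mx M ->
  (forall r, 0 < v r 0) -> (forall r, (M *m v) r 0 < v r 0) ->
  (forall r, u r 0 = 1 + (M *m u) r 0) -> forall r, 1 <= u r 0.
Proof.
move=> M0 v0 Mv uE r.
suff upos s : 0 <= u s 0.
  by rewrite uE lerDl mxE sumr_ge0// => s _; rewrite mulr_ge0.
have [t _ min_t] :=
  @arg_minP _ _ _ r xpredT (fun i => u i 0 / v i 0) isT.
have [ut|ut] := leP 0 (u t 0).
  rewrite -(@pmulr_lge0 _ (v s 0)^-1) ?invr_gt0// (le_trans _ (min_t s _))//.
  by rewrite divr_ge0// ltW.
have ct : u t 0 / v t 0 < 0 by rewrite pmulr_llt0// invr_gt0.
have uv q : (u t 0 / v t 0 *: v) q 0 <= u q 0.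
  by rewrite mxE -ler_pdivlMr// min_t.
have := le_mulmx_nonneg M0 uv t; rewrite -scalemxAr mxE => h.
have := Mv t; rewrite -(ltr_nM2l ct) [ltLHS]mulfVK ?gt_eqF// => h'.
by move: (uE t); lra.
Qed.

Lemma continuous_det (T : topologicalType) (n : nat) (N : T -> 'M[R]_n) :
  (forall i j, continuous (fun t => N t i j)) ->
  continuous (fun t => \det (N t)).
Proof.
move=> cN; apply: (@continuous_big R _ +%R) => [|s _]; first exact: add_continuous.
move=> x; apply: cvgM; first exact: cvg_cst.
apply: (@continuous_big R _ *%R) => [|i _]; first exact: mul_continuous.
exact: cN.
Qed.

Lemma continuous_bigmin (T : topologicalType) (I : Type) (s : seq I)
    (f : I -> T -> R) :
  (forall i, continuous (f i)) ->
  continuous (fun t => \big[Num.min/1]_(i <- s) f i t).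
Proof.
move=> cf; apply: (@continuous_big R _ Num.min) => [|i _]; last exact: cf.
exact: min_continuous.
Qed.

(* [u t] solves [u = 1 + M u]; it depends continuously on [t], and where it is
   positive it is at least [1], so by the intermediate value theorem its least
   entry cannot leave the half-line [1 <= x]. *)
Lemma supersolution_continuation (M : R -> 'M[R]_m) (a b : R) v :
  a <= b -> (forall t, a <= t <= b -> nonneg_mx (M t)) ->
  (forall i j, {within `[a, b], continuous (fun t => M t i j)}) ->
  (forall t, a <= t <= b -> \det (1%:M - M t) != 0) ->
  (forall r, 0 < v r 0) -> (forall r, (M a *m v) r 0 < v r 0) ->
  exists u : 'cV[R]_m,
    forall r, 1 <= u r 0 /\ (M b *m u) r 0 < u r 0.
Proof.
move=> ab M0 cM det0 v0 Mv.
pose u t : 'cV[R]_m := invmx (1%:M - M t) *m const_mx 1.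
have uE t : a <= t <= b -> forall r, u t r 0 = 1 + (M t *m u t) r 0.
  move=> tab r; apply/eqP; rewrite -subr_eq; apply/eqP.
  have : (1%:M - M t) *m u t = const_mx 1.
    by rewrite /u mulKVmx// unitmxE unitfE det0.
  by rewrite mulmxBl mul1mx => /matrixP/(_ r 0); rewrite !mxE.
have u_ge1 t : a <= t <= b -> (forall r, 0 < u t r 0) -> forall r, 1 <= u t r 0.
  move=> tab ut0 r; rewrite uE// lerDl mxE sumr_ge0// => s _.
  by apply: mulr_ge0; [exact: M0|exact: ltW].
have u_cont r : {within `[a, b], continuous (fun t => u t r 0)}.
  have cN i j : {within `[a, b], continuous (fun t => (1%:M - M t) i j)}.
    rewrite (_ : (fun t => _) = fun t => (1%:M : 'M[R]_m) i j - M t i j); last first.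
      by apply/funext => t; rewrite !mxE.
    by move=> x; apply: cvgB; [exact: cvg_cst|exact: cM].
  have cdet : {within `[a, b], continuous (fun t => \det (1%:M - M t))}.
    exact: (@continuous_det (subspace `[a, b]) m (fun t => 1%:M - M t) cN).
  have ccof i j : {within `[a, b], continuous (fun t => cofactor (1%:M - M t) i j)}.
    move=> x; apply: cvgM; first exact: cvg_cst.
    apply: (@continuous_det (subspace `[a, b])) => k l.
    rewrite (_ : (fun t => _) = fun t => (1%:M - M t) (lift i k) (lift j l)).
      exact: cN.
    by apply/funext => t; rewrite !mxE.
  (* Cramer's rule exhibits the solution as a quotient of continuous functions with nonvanishing
     denominator. *)
  pose w t := (\det (1%:M - M t))^-1 * \sum_s cofactor (1%:M - M t) s r.
  have uw : {in `[a, b], (fun t => u t r 0) =1 w}.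
    move=> t; rewrite in_itv/= => tab.
    rewrite /u /invmx unitmxE unitfE det0// /w -scalemxAl !mxE.
    by congr (_ * _); apply: eq_bigr => s _; rewrite !mxE mulr1.
  apply: (@subspace_eq_continuous _ `[a, b]%classic _ w).
    by move=> t; rewrite inE => tab; exact/esym/uw.
  apply/subspace_continuousP => x xab; apply: cvgM.
    apply: cvgV; last by move/subspace_continuousP: cdet; exact.
    by apply: det0; move: xab; rewrite /= in_itv.
  apply: (@cvg_big _ _ +%R) => [|s _]; first exact: add_continuous.
  by have /subspace_continuousP := ccof s r; exact.
(* The default value 1 is harmless: [g t] is at least 1 exactly when all entries are. *)
pose g t := \big[Num.min/1]_r u t r 0.
have g_cont : {within `[a, b], continuous g} by exact: continuous_bigmin.
have g_pos t : a <= t <= b -> 0 < g t -> forall r, 1 <= u t r 0.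
  move=> tab gt0; apply: u_ge1 => // r; apply: (lt_le_trans gt0).
  exact: bigmin_le.
have g_ge1 t : (forall r, 1 <= u t r 0) -> 1 <= g t.
  by move=> ut; apply/bigmin_geP; split.
have aab : a <= a <= b by rewrite lexx.
have bab : a <= b <= b by rewrite lexx ab.
have ua := solution_ge1_of_supersolution (M0 a aab) v0 Mv (uE a aab).
have ub : forall r, 1 <= u b r 0.
  have [gb|gb] := ltP (2^-1) (g b).
    by apply: g_pos => //; apply: lt_trans gb; rewrite invr_gt0.
  (* A positive value of [g] is at least 1, so the value 1/2 is never taken on [a, b]. *)
  have [|c] := @IVT R g a b (2^-1) ab g_cont.
    rewrite ge_min le_max gb orbT/= (le_trans _ (g_ge1 a ua))//.
    by rewrite invf_le1// ler1n.
  rewrite in_itv/= => cab gc.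
  have := g_ge1 c (g_pos c cab _); rewrite gc invr_gt0 ltr0n => /(_ isT).
  by rewrite leNgt invf_lt1 ?ltr0n// ltr1n.
by exists (u b) => r; split=> //; rewrite [ltRHS]uE// ltrDr.
Qed.

End strict_supersolution.

(** * Sums over jumps *)

Section sums.
Variable R : realType.

Lemma esum_fin (T : finType) (a : T -> \bar R) : (forall t, 0 <= a t)%E ->
  (\esum_(t in [set: T]) a t = \sum_t a t)%E.
Proof.
move=> a0; rewrite esum_fset//; last exact: finite_finset.
rewrite [RHS](fsbig_seq _ a (index_enum_uniq T)).
by congr (\sum_(t \in _) a t)%E; apply/seteqP; split => t //= _; exact: mem_index_enum.
Qed.

Lemma esum_int (a : int -> \bar R) : (forall k, 0 <= a k)%E ->
  (\esum_(k in [set: int]) a k =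
   \sum_(0 <= n <oo) a n%:Z + \sum_(0 <= n <oo) a (- n.+1%:Z)%R)%E.
Proof.
move=> a0; rewrite (esumID [set k : int | 0 <= k])// !setTI.
rewrite !nneseries_esumT//; congr (_ + _)%E; apply: reindex_esum; split.
- by move=> n _.
- by move=> m n _ _ [].
- by case=> [n|n]// _; exists n.
- by move=> n _ /=; rewrite oppr_ge0.
- by move=> m n _ _ /oppr_inj [].
- by case=> [n|n]// /= h; exists n => //; rewrite NegzE.
Qed.

(** A limit in [bisum] is a mere default value when its series diverges, hence the finiteness
    hypothesis. *)
Lemma bisum_esum (f : int -> R) : (forall k, 0 <= f k) ->
  (\esum_(k in [set: int]) (f k)%:E < +oo)%E ->
  ((bisum f)%:E = \esum_(k in [set: int]) (f k)%:E)%E.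
Proof.
move=> f0 foo; move: (foo); rewrite esum_int// => foo'.
have lim_part (g : nat -> R) : (forall n, 0 <= g n) ->
    (\sum_(0 <= n <oo) (g n)%:E < +oo)%E ->
    ((limn (series g : nat -> R^o))%:E = \sum_(0 <= n <oo) (g n)%:E)%E.
  move=> g0 goo; rewrite (@summable_nneseries_lim R xpredT)//.
    by move=> i _; rewrite lee_fin.
  rewrite /summable -(@nneseries_esum _ _ xpredT)//.
  by under eq_eseriesr do rewrite gee0_abs ?lee_fin//.
rewrite /bisum EFinD; congr (_ + _)%E; apply: lim_part => //.
  by apply: le_lt_trans foo'; rewrite leeDl// nneseries_ge0// => n _ _; rewrite lee_fin.
by apply: le_lt_trans foo'; rewrite leeDr// nneseries_ge0// => n _ _; rewrite lee_fin.
Qed.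

Lemma summable_below_radius (a : nat -> R) (r : R) : (forall n, 0 <= a n) ->
  0 <= r -> (r%:E < convergence_radius a)%E ->
  (\sum_(0 <= n <oo) (a n * r ^+ n)%:E < +oo)%E.
Proof.
move=> a0 r0 /ereal_sup_gt[_ [t [t0 cvt] <-]]; rewrite lte_fin => rt.
apply: (@le_lt_trans _ _ (limn (series (fun n => a n * t ^+ n)))%:E); last exact: ltry.
apply: lime_le; first by apply: is_cvg_nneseries => n _ _; rewrite lee_fin mulr_ge0// exprn_ge0.
apply: nearW => n; rewrite sumEFin lee_fin.
apply: (@le_trans _ _ (series (fun n => a n * t ^+ n) n)).
  by apply: ler_sum => k _; rewrite ler_wpM2l// lerXn2r// ?nnegrE// ltW.
apply: nondecreasing_cvgn_le => //; apply/nondecreasing_seqP => k.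
by rewrite /series/= big_nat_recr//= lerDl mulr_ge0// exprn_ge0.
Qed.

End sums.

(** [ppart (- k)] is the descent of a jump k, and [ppart (i + k)] the level it reaches from level i
    when stopped at level 0. *)
Definition ppart (k : int) : nat := if k is Posz n then n else 0%N.

Lemma ppartB (k : int) : k = (ppart k)%:Z - (ppart (- k))%:Z.
Proof. by case: k => [[|n]|n] //=; rewrite ?subr0 ?sub0r ?NegzE. Qed.

Lemma ppart_gt0 (k : int) : 0 < k -> (ppart k)%:Z = k.
Proof. by case: k. Qed.

Lemma ppart_le0 (k : int) : k <= 0 -> ppart k = 0%N.
Proof. by case: k => [[|n]|n]. Qed.

Section jump_sum.
Variables (R : realType) (m : nat) (A : int -> 'M[R]_m).
Hypothesis A_ge0 : forall k, nonneg_mx (A k).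
Implicit Types (f g : int -> 'I_m -> R) (r s : 'I_m).

(** Row r of the blocks is read as the law of a pair (jump, new phase), and this is the expectation
    of f. Extended values accommodate a possibly infinite mean descent. *)
Definition jump_sum r f : \bar R :=
  (\esum_(p in [set: int * 'I_m]) (A p.1 r p.2 * f p.1 p.2)%:E)%E.

Lemma jump_sum_ge0 r f : (forall k s, 0 <= f k s) -> (0 <= jump_sum r f)%E.
Proof. by move=> f0; apply: esum_ge0 => p _; rewrite lee_fin mulr_ge0// A_ge0. Qed.

Lemma le_jump_sum r f g : (forall k s, f k s <= g k s) ->
  (jump_sum r f <= jump_sum r g)%E.
Proof. by move=> fg; apply: le_esum => p _; rewrite lee_fin ler_wpM2l// A_ge0. Qed.

Lemma jump_sumD r f g : (forall k s, 0 <= f k s) -> (forall k s, 0 <= g k s) ->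
  jump_sum r (fun k s => f k s + g k s) = (jump_sum r f + jump_sum r g)%E.
Proof.
move=> f0 g0; rewrite /jump_sum -esumD; last 2 first.
- by move=> p _; rewrite lee_fin mulr_ge0// A_ge0.
- by move=> p _; rewrite lee_fin mulr_ge0// A_ge0.
by apply: eq_esum => p _; rewrite mulrDr EFinD.
Qed.

Lemma jump_sumZ r (c : R) f : 0 <= c -> (forall k s, 0 <= f k s) ->
  jump_sum r (fun k s => c * f k s) = (c%:E * jump_sum r f)%E.
Proof.
move=> c0 f0; rewrite /jump_sum -esumZl//; last first.
  by move=> p; rewrite lee_fin mulr_ge0// A_ge0.
by apply: eq_esum => p _; rewrite mulrCA EFinM.
Qed.

Lemma jump_sumE r f : (forall k s, 0 <= f k s) ->
  (jump_sum r f = \sum_s \esum_(k in [set: int]) (A k r s * f k s)%:E)%E.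
Proof.
move=> f0; have a0 k s : (0 <= (A k r s * f k s)%:E)%E.
  by rewrite lee_fin mulr_ge0// A_ge0.
rewrite -esum_fin; last by move=> s; exact: esum_ge0.
rewrite esum_swap// esum_esum//; congr (esum _ _).
by apply/seteqP; split.
Qed.

Lemma jump_sum_entry r s f : (forall k s, 0 <= f k s) ->
  (\esum_(k in [set: int]) (A k r s * f k s)%:E <= jump_sum r f)%E.
Proof.
move=> f0; rewrite jump_sumE// (bigD1 s)//= leeDl// sume_ge0// => t _.
by apply: esum_ge0 => k _; rewrite lee_fin mulr_ge0// A_ge0.
Qed.

Lemma mxbisumE (h : int -> R) r s : (forall k, 0 <= h k) ->
  (jump_sum r (fun k _ => h k) < +oo)%E ->
  ((mxbisum (fun k => h k *: A k) r s)%:E =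
   \esum_(k in [set: int]) (A k r s * h k)%:E)%E.
Proof.
move=> h0 hoo; rewrite mxE (_ : (fun k => _) = fun k => A k r s * h k); last first.
  by apply/funext => k; rewrite mxE mulrC.
rewrite bisum_esum// => [k|]; first by rewrite mulr_ge0// A_ge0.
exact: le_lt_trans (jump_sum_entry _ _ _) hoo.
Qed.

Lemma mxbisum_mulmx (h : int -> R) (u : 'cV[R]_m) r : (forall k, 0 <= h k) ->
  (forall s, 0 <= u s 0) -> (jump_sum r (fun k _ => h k) < +oo)%E ->
  (((mxbisum (fun k => h k *: A k) *m u) r 0)%:E =
   jump_sum r (fun k s => h k * u s 0)%R)%E.
Proof.
move=> h0 u0 hoo; rewrite jump_sumE => [|k s]; last by rewrite mulr_ge0.
rewrite mxE -sumEFin; apply: eq_bigr => s _.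
rewrite EFinM mxbisumE// muleC -esumZl//; last first.
  by move=> k; rewrite lee_fin mulr_ge0// A_ge0.
by apply: eq_esum => k _; rewrite -EFinM; congr EFin; ring.
Qed.

Lemma mxbisum_ge0 (h : int -> R) : (forall k, 0 <= h k) ->
  (forall r, jump_sum r (fun k _ => h k) < +oo)%E ->
  nonneg_mx (mxbisum (fun k => h k *: A k)).
Proof.
move=> h0 hoo r s; rewrite -lee_fin mxbisumE//; apply: esum_ge0 => k _.
by rewrite lee_fin mulr_ge0// A_ge0.
Qed.

(** The radius only controls the indices k >= 1; for k <= 0 the weight is 1 and the total mass
    suffices. *)
Lemma jump_sum_radius (t : R) r : 0 <= t -> (t%:E < phi_plus A)%E ->
  (jump_sum r (fun _ _ => 1)%R < +oo)%E ->
  (jump_sum r (fun k _ => t ^+ ppart k)%R < +oo)%E.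
Proof.
move=> t0 t_lt sum1; have tX n : 0 <= t ^+ n by exact: exprn_ge0.
rewrite jump_sumE//; apply: lte_sum_pinfty => s _.
rewrite esum_int => [|k]; last by rewrite lee_fin mulr_ge0// A_ge0.
apply: lte_add_pinfty; last first.
  apply: le_lt_trans sum1; apply: le_trans (jump_sum_entry r s _) => //.
  rewrite esum_int => [|k]; last by rewrite lee_fin mulr_ge0// A_ge0.
  apply: leeDr; apply: nneseries_ge0 => n _ _.
  by rewrite lee_fin mulr1 A_ge0.
rewrite nneseries_recl//; last by move=> n _; rewrite lee_fin mulr_ge0// A_ge0.
apply: lte_add_pinfty; first exact: ltry.
pose a n : R := if n == 0%N then 0 else A n%:Z r s.
have a0 n : 0 <= a n by rewrite /a; case: eqP => // _; exact: A_ge0.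
have : (t%:E < convergence_radius a)%E.
  apply: (lt_le_trans t_lt); exact: (@bigmin_le _ _ _ _ (r, s)).
move=> /(summable_below_radius a0 t0); apply: le_lt_trans.
rewrite [leRHS]nneseries_recl//; last by move=> n _; rewrite lee_fin mulr_ge0.
rewrite {1}/a mul0r add0e.
rewrite -(@nneseries_addn _ (fun n => (a n * t ^+ n)%:E) 1); last first.
  by move=> n; rewrite lee_fin mulr_ge0.
rewrite -(@nneseries_addn _ (fun n => (A n%:Z r s * t ^+ ppart n%:Z)%:E) 1); last first.
  by move=> n; rewrite lee_fin mulr_ge0// A_ge0.
apply: lee_nneseries => [n _ _|n _]; first by rewrite lee_fin mulr_ge0// A_ge0.
by rewrite addn1.
Qed.

End jump_sum.

(** * One step of the chain from a positive level *)

Section kernel.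
Variables (R : realType) (m : nat) (A B : int -> 'M[R]_m).
Hypothesis A_ge0 : forall k, nonneg_mx (A k).
Hypothesis B_ge0 : forall k, nonneg_mx (B k).
Hypothesis P_stoch : stochastic_kernel (GIG1_kernel A B).
Implicit Types (f : state m -> R) (r s : 'I_m).

Lemma kernel_split i r f : (forall y, 0 <= f y) ->
  (kernel_apply (GIG1_kernel A B) f (i.+1, r) =
   \sum_s (B (- i.+1%:Z)%R r s * f (0%N, s))%:E +
   \esum_(p in [set p : int * 'I_m | (0 < i.+1%:Z + p.1)%R])
     (A p.1 r p.2 * f (ppart (i.+1%:Z + p.1)%R, p.2))%:E)%E.
Proof.
move=> f0; rewrite /kernel_apply.
have P0 x y : 0 <= GIG1_kernel A B x y by case: P_stoch.
rewrite (esumID [set y : state m | y.1 = 0%N]); last first.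
  by move=> y _; rewrite lee_fin mulr_ge0.
rewrite !setTI; congr (_ + _)%E.
  rewrite -esum_fin; last by move=> s; rewrite lee_fin mulr_ge0// B_ge0.
  rewrite (@reindex_esum _ _ _ [set: 'I_m] _ (fun s => (0%N, s)))//.
  by split=> [s _//|s t _ _ [->]//|[[|j] s]//= _]; exists s.
rewrite (@reindex_esum _ _ _ [set p : int * 'I_m | (0 < i.+1%:Z + p.1)%R] _
  (fun p => (ppart (i.+1%:Z + p.1), p.2))).
  apply: eq_esum => -[k s] /= k0; congr (_ * _)%:E.
  have := ppart_gt0 k0; case: (ppart _) => [|j] kj; first by rewrite -kj in k0.
  by rewrite /GIG1_kernel /= kj addrAC subrr add0r.
split=> [[k s] /= k0|[k s] [k' s'] /=|[[|j] s]//= _].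
- by move=> h; have := ppart_gt0 k0; rewrite h => h'; rewrite -h' in k0.
- rewrite !inE /= => /ppart_gt0 k0 /ppart_gt0 k0' [kk ->].
  by move: k0; rewrite kk k0' => /addrI ->.
- exists (j.+1%:Z - i.+1%:Z, s); rewrite /= addrCA subrr addr0//.
Qed.

Lemma jump_sum1_le1 r : (jump_sum A r (fun _ _ => 1)%R <= 1)%E.
Proof.
apply: ub_ereal_sup => _ [X [finX _] <-].
have [q Xq] := (finite_seqP X).1 finX.
pose i := (\max_(p <- q) ppart (- p.1))%N.
have i_ge p : X p -> (ppart (- p.1)%R <= i)%N.
  by rewrite Xq /= => Xp; rewrite /i; apply: leq_bigmax_seq.
rewrite -esum_fset//; last by move=> p _; rewrite lee_fin mulr_ge0// A_ge0.
have [_ /(_ (i.+1, r)) <-] := P_stoch.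
have := @kernel_split i r (fun=> 1) (fun=> ler01).
rewrite /kernel_apply; under eq_esum do rewrite mulr1.
move=> ->; apply: (@le_trans _ _
  (\esum_(p in [set p : int * 'I_m | (0 < i.+1%:Z + p.1)%R]) (A p.1 r p.2 * 1)%:E)%E).
  rewrite esum_mkcond [leRHS]esum_mkcond; apply: le_esum => p _.
  have Ap : (0 <= (A p.1 r p.2 * 1)%:E)%E by rewrite lee_fin mulr_ge0// A_ge0.
  have [/set_mem Xp|] := boolP (p \in X); last by case: ifP.
  rewrite ifT//; apply/mem_set => /=.
  by have := i_ge p Xp; rewrite {2}[p.1]ppartB; lia.
rewrite leeDr// sume_ge0// => s _; by rewrite lee_fin mulr_ge0// B_ge0.
Qed.

Hypothesis A_stoch : stochastic_mx (mxbisum A).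

Lemma jump_sum_phase r (u : 'cV[R]_m) : (forall s, 0 <= u s 0) ->
  jump_sum A r (fun _ s => u s 0) = ((mxbisum A *m u) r 0)%:E.
Proof.
move=> u0.
have -> : mxbisum A = mxbisum (fun k => 1 *: A k).
  by congr mxbisum; apply/funext => k; rewrite scale1r.
rewrite (@mxbisum_mulmx _ _ _ _ (fun=> 1))//.
  by congr jump_sum; apply/funext => k; apply/funext => s; rewrite mul1r.
by apply: le_lt_trans (jump_sum1_le1 r) _; exact: ltry.
Qed.

Lemma jump_sum1 r : jump_sum A r (fun _ _ => 1) = 1%E.
Proof.
have := @jump_sum_phase r (const_mx 1).
under [X in jump_sum _ _ X]eq_fun do under eq_fun do rewrite mxE.
move=> -> => [|s]; last by rewrite mxE.
have [_ /(_ r) A1] := A_stoch; rewrite mxE.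
by under eq_bigr do rewrite [X in _ * X]mxE mulr1; rewrite A1.
Qed.

(* A jump below level [1] is replaced by a jump to level [0]: since [A] and
   the rows of the chain are both stochastic, the blocks [B (- i)] carry
   exactly the mass missing from the blocks [A]. *)
Lemma kernel_jump_sum i r f (c : R) : (forall y, 0 <= f y) ->
  (forall s, f (0%N, s) = c) ->
  kernel_apply (GIG1_kernel A B) f (i.+1, r) =
  jump_sum A r (fun k s => f (ppart (i.+1%:Z + k), s)).
Proof.
move=> f0 fc; have c0 : 0 <= c by rewrite -(fc r).
pose D := [set p : int * 'I_m | (0 < i.+1%:Z + p.1)%R].
have A0 (p : int * 'I_m) : (0 <= (A p.1 r p.2)%:E)%E by rewrite lee_fin A_ge0.
have sumB : (\sum_s (B (- i.+1%:Z)%R r s)%:E =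
    \esum_(p in ~` D) (A p.1 r p.2)%:E)%E.
  have AD1 : (\esum_(p in D) (A p.1 r p.2)%:E + \esum_(p in ~` D) (A p.1 r p.2)%:E = 1)%E.
    rewrite -[RHS](jump_sum1 r) /jump_sum [RHS](esumID D); last first.
      by move=> p _ /=; rewrite mulr1.
    by rewrite !setTI; congr (_ + _)%E; apply: eq_esum => p _ /=; rewrite mulr1.
  have ADfin : \esum_(p in D) (A p.1 r p.2)%:E \is a fin_num.
    rewrite ge0_fin_numE ?esum_ge0//; apply: (@le_lt_trans _ _ 1%E); last exact: ltry.
    by rewrite -AD1 leeDl// esum_ge0.
  rewrite -[LHS](addeK _ ADfin) -[RHS](addeK _ ADfin); congr (_ - _)%E.
  rewrite [RHS]addeC AD1.
  have [_ /(_ (i.+1, r)) P1] := P_stoch; rewrite -[RHS]P1.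
  have := @kernel_split i r (fun=> 1) (fun=> ler01).
  rewrite /kernel_apply; under eq_esum do rewrite mulr1.
  move=> ->; congr (_ + _)%E.
    by apply: eq_bigr => s _; rewrite mulr1.
  by apply: eq_esum => p _; rewrite mulr1.
rewrite kernel_split// /jump_sum [RHS](esumID D); last first.
  by move=> p _; rewrite lee_fin mulr_ge0// A_ge0.
rewrite !setTI addeC; congr (_ + _)%E.
under eq_bigr do rewrite fc mulrC EFinM.
rewrite -ge0_sume_distrr ?sumB; last by move=> s _; rewrite lee_fin B_ge0.
rewrite -esumZl//; apply: eq_esum => p /= /negP; rewrite -leNgt => p0.
by rewrite ppart_le0// fc -EFinM mulrC.
Qed.

End kernel.

(** * Expansions of powers *)

Section powers.
Variable R : realType.
Implicit Types x y e t : R.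

Lemma natmul_le_expr x n : 1 <= x -> n%:R * (x - 1) <= x ^+ n.
Proof.
move=> x1; elim: n => [|n IH]; first by rewrite mul0r expr0.
have := exprn_ege1 n x1; rewrite exprS -natr1; move: IH.
move: (x ^+ n) (n%:R : R) => X N; nra.
Qed.

(** Bernoulli's inequality for y / x: a larger radius absorbs the factor n. *)
Lemma natmul_expr_le x y n : 0 < x -> x < y ->
  n%:R * x ^+ n <= y ^+ n / (y / x - 1).
Proof.
move=> x0 xy; have yx : 1 < y / x by rewrite ltr_pdivlMr// mul1r.
rewrite ler_pdivlMr ?subr_gt0// mulrAC.
have := natmul_le_expr n (ltW yx); rewrite expr_div_n ler_pdivlMr ?exprn_gt0//.
Qed.

Lemma expr_tangent_le x e n : 0 <= e -> x = 1 + e ->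
  x ^+ n <= 1 + n%:R * e * x ^+ n.
Proof.
move=> e0 xe; have x1 : 1 <= x by rewrite xe lerDl.
elim: n => [|n IH]; first by rewrite expr0 !mul0r addr0.
have X1 := exprn_ege1 n x1; rewrite exprS -natr1.
have n0 : 0 <= n%:R :> R by rewrite ler0n.
have : 0 <= n%:R * e by rewrite mulr_ge0.
move: IH X1 n0 e0; rewrite xe; move: (_ ^+ n) (n%:R : R) => X N; nra.
Qed.

Lemma expr_taylor_le x e n : 0 <= e -> x = 1 + e ->
  x ^+ n <= 1 + n%:R * e + n%:R ^+ 2 * e ^+ 2 * x ^+ n.
Proof.
move=> e0 xe; have x1 : 1 <= x by rewrite xe lerDl.
elim: n => [|n IH]; first by rewrite expr0 expr2 !mul0r !addr0.
have X1 := exprn_ege1 n x1; have tg := expr_tangent_le n e0 xe.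
rewrite exprS -natr1.
have n0 : 0 <= n%:R :> R by rewrite ler0n.
have xS : x * x ^+ n = x ^+ n + e * x ^+ n by rewrite xe mulrDl mul1r.
move: (ler_wpM2l e0 tg) IH X1 n0 xS; move: (x ^+ n) (n%:R : R) => X N h1 h2 h3 h4 h5.
rewrite h5.
have h6 : 0 <= e ^+ 2 * X by rewrite mulr_ge0 ?sqr_ge0//; lra.
have h7 : 0 <= e ^+ 2 * X * N by rewrite mulr_ge0.
have h8 : 0 <= (N + 1) ^+ 2 * (e ^+ 2 * (e * X)).
  by rewrite !mulr_ge0 ?sqr_ge0//; lra.
have -> : (N + 1) ^+ 2 * e ^+ 2 * (X + e * X) =
  N ^+ 2 * e ^+ 2 * X + 2 * (e ^+ 2 * X * N) + e ^+ 2 * X +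
  (N + 1) ^+ 2 * (e ^+ 2 * (e * X)) by ring.
have : e * (1 + N * e * X) = e + e ^+ 2 * X * N by ring.
move=> h9; lra.
Qed.

(** With N = n e, Bernoulli gives x^n >= 1 + N, and (1 - N + N^2)(1 + N) = 1 + N^3 >= 1. *)
Lemma exprV_taylor_le x e n : 0 <= e -> x = 1 + e ->
  (x ^+ n)^-1 + n%:R * e <= 1 + n%:R ^+ 2 * e ^+ 2.
Proof.
move=> e0 xe; have x1 : 1 <= x by rewrite xe lerDl.
have X0 : 0 < x ^+ n by rewrite exprn_gt0// (lt_le_trans ltr01).
have n0 : 0 <= n%:R * e by rewrite mulr_ge0.
have : 1 + n%:R * e <= x ^+ n.
  elim: (n) => [|k IH]; first by rewrite mul0r addr0 expr0.
  have k0 : 0 <= k%:R * e by rewrite mulr_ge0.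
  by rewrite exprS -natr1 xe; move: IH k0; rewrite xe; move: (_ ^+ k) (k%:R : R) => X N; nra.
move=> Xn; rewrite -lerBrDr -(ler_pM2r X0) mulVf ?gt_eqF//.
set N := n%:R * e in n0 Xn *.
have -> : 1 + n%:R ^+ 2 * e ^+ 2 - N = 1 + N ^+ 2 - N by rewrite /N exprMn.
apply: (@le_trans _ _ ((1 + N ^+ 2 - N) * (1 + N))).
  have -> : (1 + N ^+ 2 - N) * (1 + N) = 1 + N ^+ 3 by ring.
  by rewrite lerDl exprn_ge0.
by rewrite ler_wpM2l//; nra.
Qed.

Lemma expr_lipschitz x y n : 1 <= y -> y <= x ->
  x ^+ n <= y ^+ n + n%:R * (x - y) * x ^+ n.
Proof.
move=> y1 yx; elim: n => [|n IH]; first by rewrite !expr0 !mul0r addr0.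
have x1 := le_trans y1 yx; have y0 : 0 <= y by lra. have x0 : 0 <= x by lra.
have YX : y ^+ n <= x ^+ n by rewrite lerXn2r.
have X1 := exprn_ege1 n x1.
have h1 := ler_wpM2l x0 IH.
rewrite !exprS -natr1; move: YX X1 h1.
have : 0 <= n%:R * (x - y) :> R by rewrite mulr_ge0// subr_ge0.
move: (x ^+ n) (y ^+ n) (n%:R : R) => X Y N h0 h2 h3 h1.
have h4 : (x - y) * Y <= (x - y) * (x * X).
  rewrite ler_wpM2l ?subr_ge0//; apply: (le_trans h2).
  by rewrite ler_peMl//; lra.
have : x * (Y + N * (x - y) * X) = y * Y + (x - y) * Y + N * (x - y) * (x * X) by ring.
have : (N + 1) * (x - y) * (x * X) = N * (x - y) * (x * X) + (x - y) * (x * X) by ring.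
lra.
Qed.

Lemma Posz_exprz x n : x ^ n%:Z = x ^+ n. Proof. by []. Qed.

Lemma Negz_exprz x n : x ^ Negz n = (x ^+ n.+1)^-1. Proof. by []. Qed.

Lemma exprz_le_ppart x t (k : int) : 1 <= x -> x <= t -> x ^ k <= t ^+ ppart k.
Proof.
move=> x1 xt; case: k => n /=.
  by rewrite lerXn2r// nnegrE (le_trans ler01)// (le_trans x1).
by rewrite expr0 Negz_exprz invf_le1 ?exprn_ege1// exprn_gt0// (lt_le_trans ltr01).
Qed.

(** The constant must be summable against the jumps. For k > 0 the slope is of order n b^n, absorbed
    by t^n since b < t; for k < 0 it is of order n x^-n, bounded by 1 / (a - 1) because x stays away
    from 1. *)
Lemma exprz_lipschitz a b t x y (k : int) : 1 < a -> b < t ->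
  a <= x <= b -> a <= y <= b ->
  x ^ k <= y ^ k + `|x - y| * (((t / b - 1)^-1 + (a - 1)^-1) * t ^+ ppart k).
Proof.
move=> a1 bt /andP[ax xb] /andP[ay yb].
have b0 : 0 < b by lra.
have t0 : 0 < t by lra.
have a0 : 0 < (a - 1)^-1 by rewrite invr_gt0; lra.
have bt0 : 0 < (t / b - 1)^-1 by rewrite invr_gt0 subr_gt0 ltr_pdivlMr// mul1r.
set D := (X in _ * (X * _)).
have D0 : 0 < D by rewrite addr_gt0.
have rest0 : 0 <= `|x - y| * (D * t ^+ ppart k).
  by rewrite mulr_ge0// mulr_ge0// ?ltW// exprn_gt0.
have x1 : 1 <= x by lra.
have y1 : 1 <= y by lra.
case: k rest0 => n /= rest0.
  have [yx|xy] := leP y x; last first.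
    apply: (@le_trans _ _ (y ^ n%:Z)); last by rewrite lerDl.
    by rewrite !Posz_exprz lerXn2r// ?nnegrE; lra.
  rewrite !Posz_exprz; apply: le_trans (expr_lipschitz n y1 yx) _.
  rewrite lerD2l ger0_norm ?subr_ge0// mulrAC mulrC ler_wpM2l ?subr_ge0//.
  apply: (@le_trans _ _ (n%:R * b ^+ n)).
    by rewrite ler_wpM2l// lerXn2r// nnegrE; lra.
  apply: le_trans (natmul_expr_le n b0 bt) _.
  by rewrite mulrC ler_wpM2r ?exprn_ge0 ?ltW// /D ltrDl.
have [xy|yx] := leP x y; last first.
  apply: (@le_trans _ _ (y ^ Negz n)); last by rewrite lerDl.
  by rewrite !Negz_exprz lef_pV2 ?posrE ?exprn_gt0 ?lerXn2r ?nnegrE//; lra.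
have X0 : 0 < x ^+ n.+1 by rewrite exprn_gt0//; lra.
have Y0 : 0 < y ^+ n.+1 by rewrite exprn_gt0//; lra.
rewrite !Negz_exprz expr0 mulr1 distrC ger0_norm ?subr_ge0//.
have h1 : n.+1%:R <= x ^+ n.+1 * (a - 1)^-1.
  rewrite ler_pdivlMr; last by lra.
  apply: le_trans (natmul_le_expr n.+1 x1).
  by rewrite ler_wpM2l//; lra.
apply: (@le_trans _ _ ((y ^+ n.+1)^-1 + (y - x) * (n.+1%:R / x ^+ n.+1))).
  have h := expr_lipschitz n.+1 x1 xy.
  have XY : 0 < (x ^+ n.+1 * y ^+ n.+1)^-1 by rewrite invr_gt0 mulr_gt0.
  move: h; rewrite -(ler_pM2r XY) invfM => h.
  apply: le_trans (_ : y ^+ n.+1 * ((x ^+ n.+1)^-1 * (y ^+ n.+1)^-1) <= _).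
    by rewrite mulrCA mulfV ?gt_eqF// mulr1.
  apply: (le_trans h); rewrite mulrDl mulVKf ?gt_eqF// lerD2l.
  rewrite [X in X <= _](_ : _ = (y - x) * (n.+1%:R / x ^+ n.+1) * (y ^+ n.+1 / y ^+ n.+1)).
    by rewrite divff ?gt_eqF// mulr1.
  by ring.
rewrite lerD2l ler_wpM2l ?subr_ge0// ler_pdivrMr// mulrC.
apply: (le_trans h1); rewrite ler_wpM2l ?ltW// /D.
by rewrite ltrDr.
Qed.

(** A remainder of order e^2, summable in k. For k = n >= 0 it contains n^2 x^n: each n is at most
    c^n / (c - 1) and x^n <= c^n, which is why c^3 <= t is required; the cross term with u costs U /
    (c - 1). For k < 0 the power is first raised to that of the truncated descent, at the cost
    K^2. *)
Lemma exprz_taylor x e t c K U u (k : int) : 0 <= e -> x = 1 + e -> x <= c ->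
  1 < c -> c ^+ 3 <= t -> 0 <= u <= U ->
  x ^ k * (1 + e * u) + e * (minn (ppart (- k)) K)%:R <=
  1 + e * (ppart k)%:R + e * u +
  e ^+ 2 * (((c - 1) ^- 2 + K%:R ^+ 2 + U / (c - 1)) * t ^+ ppart k).
Proof.
move=> e0 xe xc c1 ct /andP[u0 uU].
have x1 : 1 <= x by rewrite xe lerDl.
have U0 := le_trans u0 uU.
have c10 : 0 < (c - 1)^-1 by rewrite invr_gt0 subr_gt0.
have d0 : 0 <= U / (c - 1) by rewrite mulr_ge0// ltW.
have K0 : 0 <= K%:R ^+ 2 :> R by rewrite sqr_ge0.
have cc0 : 0 < (c - 1) ^- 2 by rewrite invr_gt0 exprn_gt0// subr_gt0.
have ee0 : 0 <= e ^+ 2 by rewrite sqr_ge0.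
have eu0 : 0 <= e * u by rewrite mulr_ge0.
case: k => n /=; last first.
  rewrite expr0 mulr1 mulr0 addr0 Negz_exprz.
  set j := minn _ K.
  have Xj : (x ^+ n.+1)^-1 <= (x ^+ j)^-1.
    rewrite lef_pV2 ?posrE ?exprn_gt0 ?(lt_le_trans ltr01)//.
    by rewrite ler_weXn2l// geq_minl.
  have X1 : (x ^+ n.+1)^-1 <= 1.
    by rewrite invf_le1 ?exprn_ege1// exprn_gt0// (lt_le_trans ltr01).
  have h := exprV_taylor_le j e0 xe.
  have jK : j%:R ^+ 2 <= K%:R ^+ 2 :> R by rewrite lerXn2r ?nnegrE// ler_nat geq_minr.
  have h2 := ler_wpM2r ee0 jK.
  have h3 : (x ^+ n.+1)^-1 * (e * u) <= e * u by rewrite ler_piMl.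
  have h4 : 0 <= e ^+ 2 * ((c - 1) ^- 2 + U / (c - 1)) by rewrite mulr_ge0// addr_ge0// ltW.
  rewrite mulrDr mulr1.
  have -> : e ^+ 2 * ((c - 1) ^- 2 + K%:R ^+ 2 + U / (c - 1)) =
    e ^+ 2 * ((c - 1) ^- 2 + U / (c - 1)) + K%:R ^+ 2 * e ^+ 2 by ring.
  by move: Xj h h2 h3 h4; move: (x ^+ _)^-1 (x ^+ _)^-1 => X Y; lra.
have -> : (minn (ppart (- n%:Z)) K)%:R = 0 :> R by case: (n) => [|j]; rewrite /= min0n.
rewrite mulr0 addr0 Posz_exprz.
have x0 : 0 <= x by lra.
have c0 : 0 <= c by lra.
have XC : x ^+ n <= c ^+ n by rewrite lerXn2r.
have C0 : 0 <= c ^+ n by rewrite exprn_ge0.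
have X0 : 0 <= x ^+ n by rewrite exprn_ge0.
have nc : n%:R <= c ^+ n / (c - 1).
  by rewrite ler_pdivlMr ?subr_gt0//; apply: natmul_le_expr; exact: ltW.
have n0 : 0 <= n%:R :> R by [].
have Ct : c ^+ n * c ^+ n * c ^+ n <= t ^+ n.
  rewrite -!exprMn lerXn2r// ?nnegrE.
  - by rewrite !mulr_ge0.
  - by apply: le_trans ct; rewrite exprn_ge0.
  - by rewrite (_ : c * c * c = c ^+ 3)//; ring.
have C1 : 1 <= c ^+ n by rewrite exprn_ege1// ltW.
have T0 : 0 <= t ^+ n by rewrite (le_trans _ Ct)// !mulr_ge0.
have NX : n%:R ^+ 2 * x ^+ n <= (c - 1) ^- 2 * t ^+ n.
  apply: (@le_trans _ _ ((c ^+ n / (c - 1)) ^+ 2 * c ^+ n)).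
    by rewrite ler_pM ?sqr_ge0// lerXn2r// nnegrE (le_trans n0).
  by rewrite exprMn exprVn mulrAC mulrC (ler_wpM2l (ltW cc0))//.
have uNX : u * (n%:R * x ^+ n) <= U / (c - 1) * t ^+ n.
  apply: (@le_trans _ _ (U * (c ^+ n / (c - 1) * c ^+ n))).
    by rewrite ler_pM ?mulr_ge0// ler_pM.
  rewrite -[leRHS]mulrA ler_wpM2l// mulrAC mulrC (ler_wpM2l (ltW c10))//.
  by apply: le_trans Ct; rewrite ler_peMr// mulr_ge0.
have KT : 0 <= K%:R ^+ 2 * t ^+ n by rewrite mulr_ge0.
have ty := expr_taylor_le n e0 xe.
have tg := ler_wpM2l eu0 (expr_tangent_le n e0 xe).
have NX2 := ler_wpM2l ee0 NX.
have uNX2 := ler_wpM2l ee0 uNX.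
have KT2 := mulr_ge0 ee0 KT.
rewrite mulrDr mulr1 !mulrDl !mulrDr.
move: ty tg NX2 uNX2 KT2; clear.
move: (x ^+ n) (t ^+ n) (n%:R : R) (K%:R ^+ 2 : R) (U / (c - 1)) ((c - 1) ^- 2)
  => X T N K2 P Q.
move=> ty tg NX2 uNX2 KT2.
have e1 : e * u * (1 + N * e * X) = e * u + e ^+ 2 * (u * (N * X)) by ring.
have e2 : N ^+ 2 * e ^+ 2 * X = e ^+ 2 * (N ^+ 2 * X) by ring.
have e3 : X * (e * u) = e * u * X by ring.
have e4 : N * e = e * N by ring.
lra.
Qed.

End powers.

(** * The mean drift is negative *)

Section drift.
Variables (R : realType) (m : nat) (A B : int -> 'M[R]_m).
Hypothesis m_gt0 : (0 < m)%N.
Hypothesis A_ge0 : forall k, nonneg_mx (A k).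
Hypothesis B_ge0 : forall k, nonneg_mx (B k).
Hypothesis P_stoch : stochastic_kernel (GIG1_kernel A B).
Hypothesis P_irr : irreducible_chain (GIG1_kernel A B).
Hypothesis P_rec : positive_recurrent_chain (GIG1_kernel A B).
Hypothesis A_irr : irreducible_mx (mxbisum A).
Hypothesis A_stoch : stochastic_mx (mxbisum A).
Variable t : R.
Hypothesis t_gt1 : 1 < t.
Hypothesis t_lt : (t%:E < phi_plus A)%E.
Implicit Types r s : 'I_m.

Let t_gt0 : 0 < t := lt_trans ltr01 t_gt1.

Let tX k : 0 <= t ^+ ppart k. Proof. by rewrite exprn_ge0// ltW. Qed.

Lemma jump_sum_expr_fin r : (jump_sum A r (fun k _ => t ^+ ppart k)%R < +oo)%E.
Proof.
apply: jump_sum_radius => //; first exact: ltW.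
by apply: le_lt_trans (jump_sum1_le1 A_ge0 B_ge0 P_stoch r) _; exact: ltry.
Qed.

Lemma jump_sum_fin (f : int -> 'I_m -> R) (c : R) r : 0 <= c ->
  (forall k s, 0 <= f k s) -> (forall k s, f k s <= c * t ^+ ppart k) ->
  jump_sum A r f \is a fin_num.
Proof.
move=> c0 f0 fc; rewrite ge0_fin_numE ?jump_sum_ge0//.
apply: le_lt_trans (le_jump_sum A_ge0 r fc) _.
by rewrite jump_sumZ// lte_mul_pinfty ?lee_fin// jump_sum_expr_fin.
Qed.

Definition upward_drift r := fine (jump_sum A r (fun k _ => (ppart k)%:R)).

(** The truncation at K ensures a finite value whatever the tail of the downward jumps. *)
Definition downward_drift K r :=
  fine (jump_sum A r (fun k _ => (minn (ppart (- k)) K)%:R)).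

Lemma upward_driftE r :
  (upward_drift r)%:E = jump_sum A r (fun k _ => (ppart k)%:R).
Proof.
rewrite fineK// (@jump_sum_fin _ (t - 1)^-1)// ?invr_ge0 ?subr_ge0 ?ltW// => k s.
rewrite mulrC ler_pdivlMr ?subr_gt0//.
by apply: natmul_le_expr; exact: ltW.
Qed.

Lemma downward_driftE K r :
  (downward_drift K r)%:E = jump_sum A r (fun k _ => (minn (ppart (- k)) K)%:R).
Proof.
rewrite fineK// (@jump_sum_fin _ K%:R)// => k s.
apply: (@le_trans _ _ K%:R); first by rewrite ler_nat geq_minr.
by rewrite ler_peMr// exprn_ege1// ltW.
Qed.

Lemma ppart_sub (i : nat) (k : int) : (i <= ppart (- k) + ppart (i%:Z + k)%R)%N.
Proof.
have [k0|k0] := leP (i%:Z + k) 0.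
  by rewrite (ppart_le0 k0) addn0; have := ppartB k; lia.
by have := ppart_gt0 k0; have := ppartB k; lia.
Qed.

(** Level plus u, cut off at 0 and set to 0 on level 0, is a submartingale bounded by the level.
    Both facts rest on u <= 0: a jump to level 0 or below would give level plus u a nonpositive
    value. Such a submartingale vanishes, yet it is positive at high levels. *)
Lemma nonneg_drift_contra (g : 'I_m -> R) (u : 'cV[R]_m) (mu : R) :
  (forall r, (g r)%:E = jump_sum A r (fun k _ => (ppart (- k))%:R)) ->
  (forall r, u r 0 <= 0) -> 0 <= mu ->
  (forall r, u r 0 - (mxbisum A *m u) r 0 = upward_drift r - g r - mu) -> False.
Proof.
move=> gE u_le0 mu0 uE; pose r0 := Ordinal m_gt0.
have g0 r : 0 <= g r by rewrite -lee_fin gE jump_sum_ge0.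
pose h (y : state m) : R :=
  if y.1 == 0%N then 0 else Num.max (y.1%:R + u y.2 0) 0.
have h0 y : 0 <= h y by rewrite /h; case: ifP => // _; rewrite le_max lexx orbT.
have h_eq0 : forall x, h x = 0.
  apply: (@bounded_descent_submartingale_eq0 R (state m) _ P_stoch P_irr P_rec
    (0%N, r0) (fun y => y.1%:R) h (\sum_r g r)) => //.
  - by apply: sumr_ge0.
  - move=> [[|j] s]; rewrite /h //= ge_max ler0n andbT gerDl//.
  - move=> [[|i] r] /=.
      rewrite esum1 ?lee_fin ?sumr_ge0// => y _.
      by rewrite sub0r max_r ?mulr0// oppr_le0.
    have := @kernel_jump_sum _ _ _ _ A_ge0 B_ge0 P_stoch A_stoch i r
      (fun y => Num.max (i.+1%:R - y.1%:R) 0) i.+1%:R.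
    rewrite /kernel_apply => ->; last 2 first.
    + by move=> y; rewrite le_max lexx orbT.
    + by move=> s; rewrite subr0 max_l.
    apply: (@le_trans _ _ (g r)%:E).
      rewrite gE; apply: le_jump_sum => // k s /=.
      by rewrite ge_max ler0n andbT lerBlDr -natrD ler_nat ppart_sub.
    by rewrite lee_fin (bigD1 r)//= lerDl sumr_ge0.
  - move=> [[|i] r].
      apply: esum_ge0 => y _; rewrite lee_fin mulr_ge0//; by case: P_stoch.
    have := @kernel_jump_sum _ _ _ _ A_ge0 B_ge0 P_stoch A_stoch i r h 0 h0.
    rewrite /kernel_apply => ->//.
    rewrite {1}/h /=; case: (leP (i.+1%:R + u r 0) 0) => [_|hpos].
      by apply: jump_sum_ge0 => // k s; exact: h0.
    set J := jump_sum _ _ _.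
    (* The negative terms are moved to the right so that all jump sums have nonnegative
       integrands. *)
    suff : ((i.+1%:R + upward_drift r)%:E <=
        J + (g r - (mxbisum A *m u) r 0)%:E)%E.
      rewrite -leeBlDr//; apply: le_trans; rewrite lee_fin.
      by move: (uE r); lra.
    have -> : (i.+1%:R + upward_drift r)%:E =
        jump_sum A r (fun k _ => i.+1%:R * 1 + (ppart k)%:R).
      rewrite jump_sumD//.
      by rewrite jump_sumZ// (jump_sum1 A_ge0 B_ge0 P_stoch A_stoch) mule1 -upward_driftE.
    have -> : (g r - (mxbisum A *m u) r 0)%:E =
        jump_sum A r (fun k s => (ppart (- k))%:R + (- u) s 0).
      rewrite jump_sumD// => [|k s]; last by rewrite mxE oppr_ge0.
      rewrite (jump_sum_phase A_ge0 B_ge0 P_stoch); last by move=> s; rewrite mxE oppr_ge0.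
      by rewrite -gE mulmxN [X in (_ + X%:E)%E]mxE EFinB.
    rewrite -jump_sumD//; last by move=> k s; rewrite addr_ge0// mxE oppr_ge0.
    apply: le_jump_sum => // k s; rewrite mulr1 mxE.
    rewrite -lerBlDr /h /=; have us := u_le0 s.
    have kE : (ppart k)%:R = (ppart (- k))%:R + k%:~R :> R.
      by rewrite {3}[k]ppartB intrB addrCA subrr addr0.
    case: eqP => [n0|/eqP n0].
      have k0 : i.+1%:Z + k <= 0.
        rewrite leNgt; apply/negP => kpos; have := ppart_gt0 kpos.
        by rewrite n0 => k0; rewrite -k0 in kpos.
      have : i.+1%:R + k%:~R <= 0 :> R by rewrite -(ler_int R) intrD in k0.
      by lra.
    have k0 : 0 < i.+1%:Z + k.
      by rewrite ltNge; apply: contra n0 => /ppart_le0 ->.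
    have -> : (ppart (i.+1%:Z + k))%:R = i.+1%:R + k%:~R :> R.
      by rewrite -[LHS]/((ppart (i.+1%:Z + k))%:Z%:~R) (ppart_gt0 k0) intrD.
    by rewrite le_max; apply/orP; left; lra.
have := h_eq0 ((Num.bound (- u r0 0)).+1, r0); rewrite /h /=.
have := archi_boundP (_ : 0 <= - u r0 0); rewrite oppr_ge0 => /(_ (u_le0 r0)).
rewrite -natr1; set N := (Num.bound _)%:R => hN.
by case: (leP (N + 1 + u r0 0) 0); lra.
Qed.

(** Constants are harmonic, so the sign of a solution can be chosen: nonpositive for the
    submartingale, nonnegative for the supersolution. *)
Lemma poisson_shift (G : 'M[R]_m) (p : 'rV[R]_m) (b : 'cV[R]_m) (c : R) :
  G - mxbisum A *m G = 1%:M - (const_mx 1 : 'cV_m) *m p ->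
  let u := G *m b + const_mx c in
  forall r, u r 0 - (mxbisum A *m u) r 0 = b r 0 - \sum_s p 0 s * b s 0.
Proof.
move=> GE u r.
have Ac : mxbisum A *m (const_mx c : 'cV_m) = const_mx c.
  apply/matrixP => i j; rewrite mxE [RHS]mxE.
  under eq_bigr do rewrite [X in _ * X]mxE.
  by rewrite -mulr_suml (A_stoch.2 i) mul1r.
have : u - mxbisum A *m u = b - (const_mx 1 : 'cV_m) *m (p *m b).
  rewrite /u mulmxDr Ac opprD addrACA subrr addr0 !mulmxA -!mulmxBl GE.
  by rewrite mulmxBl mul1mx.
move=> /(congr1 (fun M : 'cV[R]_m => M r 0)); rewrite !mxE big_ord1 !mxE mul1r.
exact.
Qed.

(* If no truncated drift is negative, the downward drift is finite by monotone
   convergence, the drift is nonnegative and [y.1%:R + u y.2] is, off level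
   [0], a submartingale with bounded mean descent. *)
Lemma negative_truncated_drift (G : 'M[R]_m) (p : 'rV[R]_m) :
  (forall r, 0 < p 0 r) ->
  G - mxbisum A *m G = 1%:M - (const_mx 1 : 'cV_m) *m p ->
  exists K, \sum_r p 0 r * (upward_drift r - downward_drift K r) < 0.
Proof.
move=> p0 GE; apply: contrapT => noK.
have drift0 K : \sum_r p 0 r * downward_drift K r <= \sum_r p 0 r * upward_drift r.
  rewrite leNgt; apply/negP => h; apply: noK; exists K.
  by under eq_bigr do rewrite mulrBr; rewrite sumrB subr_lt0.
pose gam r := jump_sum A r (fun k _ => (ppart (- k))%:R).
have gam0 r : (0 <= gam r)%E by exact: jump_sum_ge0.

have sum_gam : (\sum_r (p 0 r)%:E * gam r <= (\sum_r p 0 r * upward_drift r)%:E)%E.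
  have Ap (n : nat) r (q : int * 'I_m) : (0 <= (A q.1 r q.2 * n%:R)%:E)%E.
    by rewrite lee_fin mulr_ge0// A_ge0.
  have pAp (n : nat) r (q : int * 'I_m) : (0 <= (p 0 r)%:E * (A q.1 r q.2 * n%:R)%:E)%E.
    by rewrite mule_ge0// lee_fin ltW.
  under eq_bigr do rewrite /gam /jump_sum -esumZl ?(ltW (p0 _))//.
  rewrite -esum_sum//.
  apply: ub_ereal_sup => _ [X [finX _] <-].
  have [q Xq] := (finite_seqP X).1 finX.
  (* On a finite set of jumps, truncation at the largest descent changes nothing, so the bound on
     truncated drifts passes to the supremum. *)
  pose K := (\max_(x <- q) ppart (- x.1)%R)%N.
  rewrite -esum_fset//; last by move=> x _; apply: sume_ge0.
  apply: (@le_trans _ _ (\sum_r (p 0 r)%:E * (downward_drift K r)%:E)%E); last first.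
    by under eq_bigr do rewrite -EFinM; rewrite sumEFin lee_fin.
  under [leRHS]eq_bigr do rewrite downward_driftE /jump_sum -esumZl ?(ltW (p0 _))//.
  rewrite -[leRHS]esum_sum// esum_mkcond; apply: le_esum => x _.
  case: ifPn => [/set_mem|_]; last by apply: sume_ge0.
  rewrite Xq /= => xq; apply: lee_sum => r _.
  by rewrite (_ : minn _ _ = ppart (- x.1)%R)//; apply/minn_idPl/leq_bigmax_seq.
have gam_fin r : gam r \is a fin_num.
  rewrite ge0_fin_numE// ltey; apply/eqP => gr.
  move: sum_gam; rewrite (bigD1 r)//= gr gt0_muley ?lte_fin//.
  rewrite addye ?leye_eq// gt_eqF// (lt_le_trans (ltNyr 0))// sume_ge0// => s _.
  by rewrite mule_ge0// lee_fin ltW.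
pose g r := fine (gam r).
have gE r : (g r)%:E = gam r by rewrite fineK.
pose b : 'cV[R]_m := \col_r (upward_drift r - g r).
pose c := - \sum_r `|(G *m b) r 0|.
have uE := @poisson_shift G p b c GE.
apply: (@nonneg_drift_contra g (G *m b + const_mx c) (\sum_s p 0 s * b s 0) gE).
- move=> r; rewrite [X in X <= _]mxE [const_mx _ _ _]mxE /c subr_le0.
  apply: (le_trans (ler_norm _)); rewrite (bigD1 r)//= lerDl sumr_ge0//.
- under eq_bigr do rewrite mxE mulrBr.
  rewrite sumrB subr_ge0 -lee_fin; apply: le_trans sum_gam.
  by rewrite -sumEFin; apply: lee_sum => r _; rewrite EFinM gE.
- by move=> r; rewrite uE mxE.
Qed.

Lemma Astar_finite (w : R) r : 1 <= w <= t ->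
  (jump_sum A r (fun k _ => w ^ k)%R < +oo)%E.
Proof.
move=> /andP[w1 wt]; apply: le_lt_trans (jump_sum_expr_fin r).
by apply: le_jump_sum => // k _; exact: exprz_le_ppart.
Qed.

Lemma Astar_ge0 (w : R) : 1 <= w <= t -> nonneg_mx (Astar A w).
Proof.
move=> wt; have w0 : 0 <= w by case/andP: wt => w1 _; apply: le_trans w1.
by apply: mxbisum_ge0 => // [k|r]; [exact: exprz_ge0|exact: Astar_finite].
Qed.

Lemma Astar_mulmx (w : R) (u : 'cV[R]_m) r : 1 <= w <= t ->
  (forall s, 0 <= u s 0) ->
  ((Astar A w *m u) r 0)%:E = jump_sum A r (fun k s => w ^ k * u s 0).
Proof.
move=> wt u0; have w0 : 0 <= w by case/andP: wt => w1 _; apply: le_trans w1.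
by apply: mxbisum_mulmx => // [k|]; [exact: exprz_ge0|exact: Astar_finite].
Qed.

(* With [w = 1 + e] and [u] the solution of the Poisson equation, the vector
   [1 + e u] is a strict supersolution to first order in [e]. *)
Lemma supersolution_near1 (z : R) : 1 < z -> exists (w : R) (v : 'cV[R]_m),
  [/\ 1 < w <= z, w <= t, forall r, 0 < v r 0 &
      forall r, (Astar A w *m v) r 0 < v r 0].
Proof.
move=> z1; have [G [p [p0 GE]]] := poisson_equation A_stoch A_irr.
have [K driftK] := negative_truncated_drift p0 GE.
set mu := (X in X < 0) in driftK.
pose b : 'cV[R]_m := \col_r (upward_drift r - downward_drift K r).
pose c0 := \sum_r `|(G *m b) r 0|.
pose u := G *m b + const_mx c0.
have uE r : u r 0 - (mxbisum A *m u) r 0 = b r 0 - mu.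
  rewrite (poisson_shift b c0 GE); congr (_ - _).
  by apply: eq_bigr => s _; rewrite mxE.
have u0 r : 0 <= u r 0.
  rewrite mxE [const_mx _ _ _]mxE -lerBlDl sub0r.
  apply: (@le_trans _ _ `|(G *m b) r 0|); first by rewrite -normrN ler_norm.
  by rewrite /c0 (bigD1 r)//= lerDl sumr_ge0.
pose U := \sum_r u r 0.
have uU r : u r 0 <= U by rewrite /U (bigD1 r)//= lerDl sumr_ge0.
have [c c1 ct] : exists2 c : R, 1 < c & c ^+ 3 <= t.
  (* Capping t at 2 gives y = (t' - 1) / 7 <= 1, whence (1 + y)^3 <= 1 + 7 y = t'. *)
  pose t' := Num.min t 2; have t'1 : 1 < t' by rewrite lt_min t_gt1 ltr1n.
  have t'2 : t' <= 2 by rewrite ge_min lexx orbT.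
  exists (1 + (t' - 1) / 7); first by rewrite ltrDl divr_gt0// subr_gt0.
  apply: (@le_trans _ _ t'); last by rewrite ge_min lexx.
  set y := (t' - 1) / 7; have -> : t' = 1 + 7 * y by rewrite /y; field.
  have y0 : 0 < y by rewrite divr_gt0// subr_gt0.
  have y1 : y <= 1 by rewrite /y; lra.
  rewrite -subr_ge0 (_ : _ - _ = y * (1 - y) * (4 + y)); last by ring.
  by rewrite !mulr_ge0 ?subr_ge0//; lra.
pose q r := fine (jump_sum A r (fun k _ => t ^+ ppart k)).
have qE r : (q r)%:E = jump_sum A r (fun k _ => t ^+ ppart k).
  by rewrite fineK// (@jump_sum_fin _ 1)// => k s; rewrite mul1r.
have q0 r : 0 <= q r by rewrite -lee_fin qE jump_sum_ge0.
pose D := (c - 1) ^- 2 + K%:R ^+ 2 + U / (c - 1).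
have D0 : 0 <= D.
  have c10 : 0 <= (c - 1)^-1 by rewrite invr_ge0 subr_ge0 ltW.
  rewrite addr_ge0 ?mulr_ge0// ?sumr_ge0//.
  by rewrite addr_ge0 ?sqr_ge0// -exprVn sqr_ge0.
pose Q := \sum_r q r.
have DQ0 : 0 <= D * Q by rewrite mulr_ge0// sumr_ge0.
(* The first two bounds keep 1 + e below c and z; the last makes the remainder e^2 D Q smaller than
   the first-order gain - e mu. *)
pose e := Num.min (Num.min (c - 1) (z - 1)) (- mu / (D * Q + 1)).
have e_gt0 : 0 < e.
  by rewrite !lt_min !subr_gt0 c1 z1 divr_gt0 ?oppr_gt0//; lra.
have ec : 1 + e <= c by rewrite -lerBrDl !ge_min lexx.
have ez : 1 + e <= z by rewrite -lerBrDl !ge_min lexx orbT.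
have eDQ : e * (D * Q) < - mu.
  have : e * (D * Q + 1) <= - mu.
    by rewrite -ler_pdivlMr ?ge_min ?lexx ?orbT//; lra.
  by rewrite mulrDr mulr1; lra.
have et : 1 + e <= t.
  by apply: le_trans ct; apply: (le_trans ec); rewrite ler_eXnr// ltW.
exists (1 + e), (const_mx 1 + e *: u).
have vE s : (const_mx 1 + e *: u) s 0 = 1 + e * u s 0.
  by rewrite mxE [const_mx _ _ _]mxE [(e *: u) _ _]mxE.
have v0 s : 0 < (const_mx 1 + e *: u) s 0.
  by rewrite vE ltr_wpDr// mulr_ge0// ltW.
split=> //; first by rewrite ltrDl e_gt0.
move=> r.
have e0 := ltW e_gt0.
have : (((Astar A (1 + e) *m (const_mx 1 + e *: u)) r 0 + e * downward_drift K r)%:E <=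
   (1 + e * upward_drift r + e * (mxbisum A *m u) r 0 + e ^+ 2 * (D * q r))%:E)%E.
  have w1t : 1 <= 1 + e <= t by rewrite lerDl e0.
  rewrite EFinD Astar_mulmx//; last by move=> s; exact: ltW.
  rewrite EFinM downward_driftE -jump_sumZ// -jump_sumD//; last 2 first.
  - by move=> k s; rewrite mulr_ge0 ?exprz_ge0 ?(ltW (v0 s))// addr_ge0.
  - by move=> k s; rewrite mulr_ge0.
  rewrite 3!EFinD -(jump_sum1 A_ge0 B_ge0 P_stoch A_stoch r).
  rewrite (EFinM e (upward_drift r)) upward_driftE -jump_sumZ// -jump_sumD//; last first.
    by move=> k s; rewrite mulr_ge0.
  rewrite (EFinM e (_ 0)) -(jump_sum_phase A_ge0 B_ge0 P_stoch r u0) -jump_sumZ//.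
  rewrite -jump_sumD//; last 2 first.
  - by move=> k s; rewrite addr_ge0// mulr_ge0.
  - by move=> k s; rewrite mulr_ge0.
  rewrite mulrA EFinM qE -jump_sumZ//; last by rewrite mulr_ge0// sqr_ge0.
  rewrite -jump_sumD//; last 2 first.
  - by move=> k s; rewrite addr_ge0 ?mulr_ge0// addr_ge0// mulr_ge0.
  - by move=> k s; rewrite mulr_ge0// mulr_ge0// sqr_ge0.
  apply: le_jump_sum => // k s; rewrite vE -mulrA.
  by apply: exprz_taylor => //; rewrite u0 uU.
rewrite lee_fin vE => h; have uEr := uE r; rewrite [b r 0]mxE in uEr.
have qQ : q r <= Q by rewrite /Q (bigD1 r)//= lerDl sumr_ge0.
have eDq : e * (D * q r) <= e * (D * Q) by rewrite ler_wpM2l// ler_wpM2l.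
have e2 : e * (e * (D * q r)) < e * (- mu).
  by rewrite ltr_pM2l// (le_lt_trans eDq eDQ).
have e3 : e ^+ 2 * (D * q r) = e * (e * (D * q r)) by ring.
have e4 := congr1 ( *%R e) uEr.
rewrite !mulrBr in e4.
move: h e2 e4; rewrite e3 mulrN.
move: (e * (e * (D * q r))) (e * upward_drift r) (e * downward_drift K r)
  (e * u r 0) (e * (mxbisum A *m u) r 0) (e * mu) ((Astar A (1 + e) *m _) r 0).
by move=> *; lra.
Qed.

End drift.

(** * The Perron-Frobenius eigenvalue *)

Section complex_limits.
Variable R : realType.
Local Open Scope complex_scope.

Lemma cvg_real_complex (u : nat -> R) (l : R) : u @ \oo --> l ->
  ((fun n => (u n)%:C) : nat -> R[i]^o) @ \oo --> (l%:C : R[i]^o).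
Proof.
move=> ul; apply/cvgrPdist_lt => -[e e'] /=.
rewrite ltcE /= => /andP[/eqP -> e0].
near=> n.
have : `|l - u n| < e by near: n; move/cvgrPdist_lt : ul; apply.
by rewrite -rmorphB normc_def /= expr0n addr0 sqrtr_sqr ltcR.
Unshelve. all: by end_near. Qed.

Lemma bisum_real_complex (f : int -> R) : (forall k, 0 <= f k) ->
  (\esum_(k in [set: int]) (f k)%:E < +oo)%E ->
  bisum (fun k => (f k)%:C) = (bisum f)%:C.
Proof.
move=> f0; rewrite esum_int// => foo.
have lim_part (g : nat -> R) : (forall n, 0 <= g n) ->
    (\sum_(0 <= n <oo) (g n)%:E < +oo)%E ->
    limn (series (fun n => (g n)%:C) : nat -> R[i]^o) =
    (limn (series g : nat -> R^o))%:C.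
  move=> g0 goo; have cg : cvgn (series g : nat -> R^o).
    apply: (@summable_cvg R xpredT (fun n => (g n)%:E)) => [i _|].
      by rewrite lee_fin.
    rewrite /summable -(@nneseries_esum _ _ xpredT)//.
    by under eq_eseriesr do rewrite gee0_abs ?lee_fin//.
  apply: cvg_lim => //; apply: cvg_trans (cvg_real_complex cg).
  by apply: near_eq_cvg; apply: nearW => n; rewrite /series/= rmorph_sum.
rewrite /bisum rmorphD /=; congr (_ + _); apply: lim_part => //.
  by apply: le_lt_trans foo; rewrite leeDl// nneseries_ge0// => n _ _; rewrite lee_fin.
by apply: le_lt_trans foo; rewrite leeDr// nneseries_ge0// => n _ _; rewrite lee_fin.
Qed.

End complex_limits.

Section chi_lt1.
Variables (R : realType) (m : nat) (A B : int -> 'M[R]_m).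
Hypothesis m_gt0 : (0 < m)%N.
Hypothesis A_ge0 : forall k, nonneg_mx (A k).
Hypothesis B_ge0 : forall k, nonneg_mx (B k).
Hypothesis P_stoch : stochastic_kernel (GIG1_kernel A B).
Hypothesis A_stoch : stochastic_mx (mxbisum A).
Variable t : R.
Hypothesis t_gt1 : 1 < t.
Hypothesis t_lt : (t%:E < phi_plus A)%E.

(** [Omega] consists of complex points, while the continuation runs along the real axis: this turns
    a real zero of the determinant into a point of [Omega]. *)
Lemma Astar_real_complex (w : R) : 1 <= w <= t ->
  Astar_complex A (real_complex R w) = map_mx (real_complex R) (Astar A w).
Proof.
move=> wt; have w0 : 0 <= w by case/andP: wt => w1 _; apply: le_trans w1.
apply/matrixP => r s; rewrite !mxE.
rewrite -bisum_real_complex.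
- by congr bisum; apply/funext => k; rewrite !mxE rmorphM -fmorphXz.
- by move=> k; rewrite mxE mulr_ge0 ?exprz_ge0// A_ge0.
under eq_esum do rewrite mxE mulrC.
have wk k : 0 <= w ^ k by exact: exprz_ge0.
apply: le_lt_trans (jump_sum_entry A_ge0 r s (fun k _ => wk k)) _.
exact: (Astar_finite A_ge0 B_ge0 P_stoch t_gt1 t_lt).
Qed.

Lemma det_Astar_neq0 (w : R) : 1 < w <= t -> (w%:E < eta A)%E ->
  \det (1%:M - Astar A w) != 0.
Proof.
move=> /andP[w1 wt] w_eta; apply/eqP => det0.
have normw : ComplexField.Normc.normc (real_complex R w) = w.
  by rewrite /= expr0n addr0 sqrtr_sqr gtr0_norm// (lt_trans ltr01).
have : (eta A <= w%:E)%E.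
  apply: ereal_inf_lbound; exists (real_complex R w); last by rewrite normw.
  split; rewrite ?normw//; first by apply: le_lt_trans t_lt; rewrite lee_fin.
  rewrite Astar_real_complex ?(ltW w1)//.
  by rewrite -(map_mx1 (real_complex R)) -map_mxB det_map_mx det0 rmorph0.
by rewrite leNgt w_eta.
Qed.

Lemma Astar_lipschitz (a b : R) r s : 1 < a -> b < t ->
  exists2 L : R, 0 <= L & forall x y, a <= x <= b -> a <= y <= b ->
    Astar A x r s <= Astar A y r s + `|x - y| * L.
Proof.
move=> a1 bt.
pose D := (t / b - 1)^-1 + (a - 1)^-1.
pose q := fine (jump_sum A r (fun k _ => t ^+ ppart k)).
have tX k : 0 <= t ^+ ppart k by rewrite exprn_ge0// (le_trans ler01)// ltW.
have qE : q%:E = jump_sum A r (fun k _ => t ^+ ppart k).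
  rewrite fineK// (jump_sum_fin A_ge0 B_ge0 P_stoch t_gt1 t_lt (c := 1))//.
  by move=> k s'; rewrite mul1r.
have q0 : 0 <= q by rewrite -lee_fin qE jump_sum_ge0.
have [ab|ba] := leP a b; last first.
  exists 0 => // x y /andP[ax xb].
  by move: (le_lt_trans (le_trans ax xb) ba); rewrite ltxx.
have D0 : 0 <= D.
  rewrite addr_ge0// invr_ge0 subr_ge0 ?ltW//.
  by rewrite ltr_pdivlMr ?mul1r// (lt_le_trans _ ab)// (lt_trans ltr01).
exists (D * q) => [|x y xab yab]; first by rewrite mulr_ge0.
have entryE (w : R) : a <= w <= b ->
    (Astar A w r s)%:E = jump_sum A r (fun k s' => w ^ k * (delta_mx s 0 : 'cV[R]_m) s' 0).
  move=> /andP[aw wb]; rewrite -(Astar_mulmx A_ge0 B_ge0 P_stoch t_gt1 t_lt).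
  - by rewrite -colE [in RHS]mxE.
  - by apply/andP; split; lra.
  - by move=> s'; rewrite mxE.
have xX k : 0 <= x ^ k by apply: exprz_ge0; move: xab => /andP[]; lra.
have yX k : 0 <= y ^ k by apply: exprz_ge0; move: yab => /andP[]; lra.
rewrite -lee_fin EFinD entryE// entryE// mulrA EFinM qE.
have dlt (s' : 'I_m) : 0 <= (delta_mx s 0 : 'cV[R]_m) s' 0 <= 1.
  by rewrite mxE ler0n lern1 leq_b1.
rewrite -jump_sumZ ?mulr_ge0// -jump_sumD//; last 2 first.
- by move=> k s'; rewrite mulr_ge0//; case/andP: (dlt s').
- by move=> k s'; rewrite !mulr_ge0.
apply: le_jump_sum => // k s'; case/andP: (dlt s') => d0 d1.
apply: le_trans (ler_wpM2r d0 (exprz_lipschitz k a1 bt xab yab)) _.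
rewrite mulrDl lerD2l -[leRHS]mulrA -/D.
by apply: ler_piMr; rewrite // !mulr_ge0.
Qed.

Lemma continuous_Astar (a b : R) r s : 1 < a -> b < t ->
  {within `[a, b], continuous (fun x => Astar A x r s)}.
Proof.
move=> a1 bt; have [L L0 lipL] := Astar_lipschitz r s a1 bt.
apply/subspace_continuousP => x; rewrite /= in_itv /= => xab.
apply/cvgrPdist_lt => e e0.
have eL : 0 < e / (L + 1) by rewrite divr_gt0// ltr_wpDl.
near=> y.
have yab : a <= y <= b.
  have : `[a, b]%classic y by near: y; exact: withinT.
  by rewrite /= in_itv.
have xy : `|x - y| < e / (L + 1).
  near: y; apply: cvg_within.
  by have /cvgrPdist_lt := @cvg_id _ (nbhs x); apply; exact: eL.
apply: (@le_lt_trans _ _ (`|x - y| * L)).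
  rewrite /from_subspace/= ler_norml; apply/andP; split.
    by have := lipL y x yab xab; rewrite distrC; lra.
  by have := lipL x y xab yab; lra.
apply: (@le_lt_trans _ _ (`|x - y| * (L + 1))); first by rewrite ler_wpM2l// lerDl.
by rewrite -ltr_pdivlMr// ltr_wpDl.
Unshelve. all: by end_near. Qed.

Hypothesis P_irr : irreducible_chain (GIG1_kernel A B).
Hypothesis P_rec : positive_recurrent_chain (GIG1_kernel A B).
Hypothesis A_irr : irreducible_mx (mxbisum A).

Lemma chi_lt1 (z : R) (Y : 'cV[R]_m) : 1 < z -> z < t -> (z%:E < eta A)%E ->
  Astar A z *m Y = chi A z *: Y -> (forall r, 0 < Y r 0) -> chi A z < 1.
Proof.
move=> z1 zt z_eta AY Y0.
have [w [v [/andP[w1 wz] wt v0 Av]]] := supersolution_near1 m_gt0 A_ge0 B_ge0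
  P_stoch P_irr P_rec A_irr A_stoch t_gt1 t_lt z1.
have [|||u u_ge1] := @supersolution_continuation R m (Astar A) w z v wz _ _ _ v0 Av.
- move=> x /andP[wx xz]; apply: (Astar_ge0 A_ge0 B_ge0 P_stoch t_gt1 t_lt).
  by apply/andP; split; lra.
- by move=> i j; exact: continuous_Astar.
- move=> x /andP[wx xz]; apply: det_Astar_neq0.
    by apply/andP; split; lra.
  by apply: le_lt_trans z_eta; rewrite lee_fin.
apply: (eigenvalue_lt1 m_gt0 _ (fun r => lt_le_trans ltr01 (u_ge1 r).1)
  (fun r => (u_ge1 r).2) Y0 AY).
apply: (Astar_ge0 A_ge0 B_ge0 P_stoch t_gt1 t_lt).
by apply/andP; split; lra.
Qed.

End chi_lt1.

(** * The boundary level and the drift condition *)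

Section boundary.
Variables (R : realType) (m : nat) (A B : int -> 'M[R]_m).
Hypothesis B_ge0 : forall k, nonneg_mx (B k).

(** Blocks of negative index describe descents from higher levels. Without them the level-0 row is
    itself a jump law, and [phi_plus] is unchanged since it reads only positive indices. *)
Let B' (k : int) : 'M[R]_m := if k is Posz _ then B k else 0.

Lemma kernel_apply_level0_fin (z : R) (Y : 'cV[R]_m) r :
  stochastic_kernel (GIG1_kernel A B) -> 0 <= z -> (z%:E < phi_plus B)%E ->
  (forall s, 0 <= Y s 0) ->
  (kernel_apply (GIG1_kernel A B) (level_phase_function z Y) (0%N, r) < +oo)%E.
Proof.
move=> P_stoch z0 zB Y0.
have B'_ge0 k : nonneg_mx (B' k).
  by case: k => n r' s; rewrite /B' ?mxE//; exact: B_ge0.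
have jumpE (f : int -> 'I_m -> R) : (forall k s, 0 <= f k s) ->
    jump_sum B' r f =
    (\esum_(y in [set: state m]) (GIG1_kernel A B (0%N, r) y * f y.1%:Z y.2)%:E)%E.
  move=> f0; rewrite /jump_sum (esumID [set p : int * 'I_m | 0 <= p.1]); last first.
    by move=> p _; rewrite lee_fin mulr_ge0//; exact: B'_ge0.
  rewrite [X in (_ + X)%E]esum1 ?adde0 ?setTI; last first.
    by move=> [[n|n] s] /= neg; [case: (neg isT)|rewrite mxE mul0r].
  apply: (@reindex_esum _ _ _ setT _ (fun y : state m => (y.1%:Z, y.2))).
  split=> [[j s] _ /=|[j s] [j' s'] _ _ [-> ->]//|[[j|j] s]//= _]; first by [].
  by exists (j, s).
have zX k : 0 <= z ^+ ppart k by rewrite exprn_ge0.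
pose C := \sum_s Y s 0.
have C0 : 0 <= C by rewrite sumr_ge0.
have fin : (jump_sum B' r (fun k _ => z ^+ ppart k)%R < +oo)%E.
  apply: jump_sum_radius => //; rewrite jumpE//.
  under eq_esum do rewrite mulr1.
  by rewrite (P_stoch.2 (0%N, r)) ltry.
apply: (@le_lt_trans _ _ (jump_sum B' r (fun k _ => C * z ^+ ppart k))); last first.
  by rewrite jump_sumZ// lte_mul_pinfty ?lee_fin.
rewrite jumpE => [|k s]; last by rewrite mulr_ge0.
apply: le_esum => -[j s] _; rewrite lee_fin ler_wpM2l//; first by case: P_stoch.
rewrite /level_phase_function /= mulrC ler_wpM2r ?exprn_ge0//.
by rewrite /C (bigD1 s)//= lerDl sumr_ge0.
Qed.

End boundary.

Lemma lte_between (R : realType) (x : R) (y : \bar R) : (x%:E < y)%E ->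
  exists2 t : R, x < t & (t%:E < y)%E.
Proof.
case: y => [y||]//=; last by exists (x + 1); [lra|exact: ltry].
rewrite lte_fin => xy; exists ((x + y) / 2); first by lra.
by rewrite lte_fin; lra.
Qed.

Unset Implicit Arguments.

Theorem theorem3p1 (R : realType) (m : nat) (m_gt0 : (0 < m)%N)
  (A B : int -> 'M[R]_m)
  (A_ge0 : forall k, nonneg_mx (A k)) (B_ge0 : forall k, nonneg_mx (B k))
  (P_stochastic : stochastic_kernel (GIG1_kernel A B))
  (P_irreducible : irreducible_chain (GIG1_kernel A B))
  (P_aperiodic : aperiodic_chain (GIG1_kernel A B))
  (P_positive_recurrent : positive_recurrent_chain (GIG1_kernel A B))
  (A_irreducible : irreducible_mx (mxbisum A))
  (A_stochastic : stochastic_mx (mxbisum A))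
  (phi_gt1 : (1 < Order.min (phi_plus A) (phi_plus B))%E)
  (z : R) (z_gt1 : 1 < z)
  (z_lt : (z%:E < Order.min (Order.min (phi_plus A) (phi_plus B)) (eta A))%E)
  (Y : 'cV[R]_m)
  (Y_eigenvector : Astar A z *m Y = chi A z *: Y)
  (Y_ge1 : forall r, 1 <= Y r 0) :
  let P := GIG1_kernel A B in
  let V := level_phase_function z Y in
  exists (H : set (state m)) (lambda : R),
    [/\ finite_set H,
        H !=set0,
        lambda < 1,
        forall x, ~ H x -> (kernel_apply P V x <= (lambda * V x)%:E)%E &
        forall x, H x -> (kernel_apply P V x < +oo)%E].
Proof.
move=> P V.
have Y0 r : 0 < Y r 0 by apply: lt_le_trans (Y_ge1 r).
have z0 : 0 < z by apply: lt_trans z_gt1.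
move: z_lt; rewrite !lt_min => /andP[/andP[zA zB] z_eta].
have [t zt t_lt] := lte_between zA.
have t_gt1 : 1 < t by apply: lt_trans zt.
have chi1 := chi_lt1 m_gt0 A_ge0 B_ge0 P_stochastic A_stochastic t_gt1 t_lt
  P_irreducible P_positive_recurrent A_irreducible z_gt1 zt z_eta Y_eigenvector Y0.
have z1t : 1 <= z <= t by rewrite !ltW.
pose C := \sum_s Y s 0.
have YC s : Y s 0 <= C by rewrite /C (bigD1 s)//= lerDl sumr_ge0// => *; exact: ltW.
have C0 : 0 <= C by rewrite sumr_ge0// => s _; exact: ltW.
have zX k : 0 <= z ^ k by apply: exprz_ge0; exact: ltW.
(* The level-0 values of [V] are replaced by their common bound [C]. *)
have PV i r : (kernel_apply P V (i.+1, r) <=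
    (z ^+ i.+1 * (chi A z * Y r 0) + C)%:E)%E.
  pose f (y : state m) : R := if y.1 is 0 then C else V y.
  have V0 y : 0 <= V y by rewrite /V /level_phase_function mulr_ge0 ?exprn_ge0 ?ltW.
  have f0 y : 0 <= f y by rewrite /f; case: (y.1).
  apply: (@le_trans _ _ (kernel_apply P f (i.+1, r))).
    apply: le_esum => -[[|j] s] _; rewrite lee_fin ler_wpM2l//; try by case: P_stochastic.
    by rewrite /f /V /level_phase_function/= expr0 mul1r.
  rewrite (@kernel_jump_sum _ _ _ _ A_ge0 B_ge0 P_stochastic A_stochastic i r f C)//.
  have := Astar_mulmx A_ge0 B_ge0 P_stochastic t_gt1 t_lt r z1t (fun s => ltW (Y0 s)).
  rewrite Y_eigenvector [(chi A z *: Y) _ _]mxE => AY.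
  rewrite EFinD EFinM AY -[X in (_ + X)%E]mule1.
  rewrite -(jump_sum1 A_ge0 B_ge0 P_stochastic A_stochastic r).
  have zY k s : 0 <= z ^ k * Y s 0 by rewrite mulr_ge0// ltW.
  have zi0 : 0 <= z ^+ i.+1 by rewrite exprn_ge0// ltW.
  rewrite -!jump_sumZ// -jump_sumD// => [|k s|k s]; last 2 first.
  - by rewrite mulr_ge0.
  - by rewrite mulr1.
  apply: le_jump_sum => // k s; rewrite mulr1 /f /=.
  have [k0|k0] := leP (i.+1%:Z + k) 0.
    by rewrite (ppart_le0 k0) lerDr mulr_ge0.
  have := ppart_gt0 k0; case: (ppart _) => [|j] kj; first by rewrite -kj in k0.
  rewrite /V /level_phase_function /= -(Posz_exprz z j.+1) kj.
  by rewrite expfzDr ?gt_eqF// mulrA lerDl.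
(* Halfway between chi(z) and 1, leaving (1 - chi(z)) / 2 times V to absorb the boundary term C. *)
pose lambda := (1 + chi A z) / 2.
have lambda1 : lambda < 1 by rewrite /lambda; lra.
(* By Bernoulli, z^n >= n (z - 1), so above this level z^n (1 - chi(z)) / 2 exceeds C; the
   normalization Y >= 1 then compares C with V. *)
pose N := Num.bound (C / ((1 - chi A z) / 2) / (z - 1)).
exists [set x : state m | (x.1 <= N)%N], lambda; split=> //.
- apply: (@sub_finite_set _ _ (`I_N.+1 `*` setT)).
    by move=> x /= xN; split.
  by apply: finite_setX; [exact: finite_II|exact: finite_finset].
- by exists (0%N, Ordinal m_gt0).
- move=> [[|i] r] /= /negP; rewrite -ltnNge // => Ni.
  apply: (le_trans (PV i r)); rewrite lee_fin /V /level_phase_function /=.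
  have zN : C <= z ^+ i.+1 * ((1 - chi A z) / 2).
    rewrite -ler_pdivrMr; last by lra.
    apply: le_trans (natmul_le_expr i.+1 (ltW z_gt1)).
    rewrite -ler_pdivrMr ?subr_gt0//.
    apply: le_trans (ltW (archi_boundP _)) _.
      by rewrite !mulr_ge0// invr_ge0; lra.
    by rewrite ler_nat ltnW.
  have zi0 : 0 <= z ^+ i.+1 * ((1 - chi A z) / 2) by apply: le_trans zN.
  have := ler_wpM2l zi0 (Y_ge1 r); rewrite mulr1 /lambda.
  move: zN; move: (z ^+ i.+1) (Y r 0) (chi A z) => X y c; clear.
  move=> h1 h2.
  have -> : (1 + c) / 2 * (X * y) = X * (c * y) + X * ((1 - c) / 2) * y by field.
  lra.
- move=> [[|i] r] _.
    apply: kernel_apply_level0_fin => //; first exact: ltW.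
    by move=> s; exact: ltW.
  by apply: le_lt_trans (PV i r) _; exact: ltry.
Qed.
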